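(* Let $n\ge2$ and let $K$ be a convex body in $\mathbb{R}^n$. Suppose that there exists a non-empty (relatively) open subset $U$ of $\partial K$ which is strictly convex, that is, every point of $U$ is a point of local strict convexity of $\partial K$. Then $K$ is not a local maximizer for the isotropy constant $L_K$.
   Context: $\mathbb{R}^n$ carries its canonical scalar product $\langle\cdot,\cdot\rangle$ and Euclidean norm $|\cdot|$; $|B|$ denotes the volume of a Borel set $B\subset\mathbb{R}^n$. A convex body is a compact convex set with non-empty interior. Isotropy constant. For every convex body $K\subset\mathbb{R}^n$ there is a volume preserving affine map $A:\mathbb{R}^n\to\mathbb{R}^n$, unique up to orthogonal transformations, such that for some constant $M_K>0$ depending on $K$ one has, for every $y\in\mathbb{R}^n$, $\int_{AK}\langle x,y\rangle\,dx=0$ and $\int_{AK}\langle x,y\rangle^2\,dx=M_K^2|y|^2$. The isotropy constant is $L_K=M_K/|K|^{\frac{n+2}{2n}}$. Local maximizers. $K$ is a local maximizer for $L_K$ if for some $\varepsilon>0$ one has $L_{K'}\le L_K$ for all convex bodies $K'$ in $\mathbb{R}^n$ with $d(K',K)<\varepsilon$. Here $d$ may be taken to be either the Hausdorff distance or the (logarithmic) Banach–Mazur distance $\log\inf\{\lambda\ge1: K-x\subset T(K'-y)\subset\lambda(K-x)$ for some $x,y\in\mathbb{R}^n$ and some invertible linear $T\}$. Local strict convexity. A point $X_0\in\partial K$ is a point of local strict convexity of $\partial K$ if there exists no non-degenerate line segment $I\subset\partial K$ such that $X_0\in I$ (even as an end-point). *)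

(* Defs.v *)
(* R^n is the type of row vectors 'rV[R]_n, with R : realType; matrices act on the right. *)
From HB Require Import structures.
From mathcomp Require Import all_boot all_order all_algebra.
From mathcomp Require Import all_classical all_reals all_analysis.
From mathcomp Require Import measurable_realfun.

Set Implicit Arguments.
Unset Strict Implicit.
Unset Printing Implicit Defensive.

Import Order.TTheory GRing.Theory Num.Theory.
Import numFieldNormedType.Exports.

Local Open Scope classical_set_scope.
Local Open Scope ring_scope.

Lemma sigma_finite_pushforward_prod d1 d2 d3 (T1 : measurableType d1)
    (T2 : measurableType d2) (T3 : measurableType d3) (R : realType)
    (m1 : {sigma_finite_measure set T1 -> \bar R})
    (m2 : {sigma_finite_measure set T2 -> \bar R})
    (f : T1 * T2 -> T3) (g : T3 -> T1 * T2) :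
  measurable_fun setT g -> cancel f g ->
  sigma_finite setT (pushforward (m1 \x m2)%E f).
Proof.
move=> mg fK.
have /sigma_finiteP[F [TF ndF Foo]] := sigma_finiteT m1.
have /sigma_finiteP[G [TG ndG Goo]] := sigma_finiteT m2.
exists (fun k => g @^-1` (F k `*` G k)).
  rewrite -preimage_bigcup (_ : \bigcup_i _ = setT) ?preimage_setT//.
  rewrite -subTset => -[x y] _.
  have [i _ Fix] : (\bigcup_i F i) x by rewrite -TF.
  have [j _ Gjy] : (\bigcup_i G i) y by rewrite -TG.
  exists (maxn i j) => //; split => /=.
  - by move: x Fix; exact/subsetPset/ndF/leq_maxl.
  - by move: y Gjy; exact/subsetPset/ndG/leq_maxr.
move=> k; have [mF Fk] := Foo k; have [mG Gk] := Goo k; split.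
  by rewrite -[X in measurable X]setTI; apply: mg => //; exact: measurableX.
rewrite /pushforward -comp_preimage (_ : _ \o _ = id); last first.
  by apply/funext => p; exact: fK.
by rewrite preimage_id product_measure1E// lte_mul_pinfty// ge0_fin_numE.
Qed.

Section TupleMeasure.
Context d (T : measurableType d) (R : realType).

Definition tuple_cons n (p : T * n.-tuple T) : n.+1.-tuple T :=
  [tuple of p.1 :: p.2].

Lemma measurable_tuple_cons n : measurable_fun setT (@tuple_cons n).
Proof. exact: measurable_cons. Qed.

Definition tuple_uncons n (t : n.+1.-tuple T) : T * n.-tuple T :=
  (tnth t ord0, [tuple of behead t]).

Lemma measurable_tuple_uncons n : measurable_fun setT (@tuple_uncons n).
Proof.
by apply/measurable_fun_pair; [exact: measurable_tnth|exact: measurable_behead].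
Qed.

Lemma tuple_consK n : cancel (@tuple_cons n) (@tuple_uncons n).
Proof. by move=> [x t]; congr pair; exact: val_inj. Qed.

Variable m : {sigma_finite_measure set T -> \bar R}.

Section step.
Variables (n : nat) (mu : {sigma_finite_measure set (n.-tuple T) -> \bar R}).

Definition tuple_measure_step : set (n.+1.-tuple T) -> \bar R :=
  pushforward (m \x mu)%E (@tuple_cons n).

Let step0 : tuple_measure_step set0 = 0%E.
Proof. by rewrite /tuple_measure_step /pushforward preimage_set0 measure0. Qed.

Let step_ge0 A : (0 <= tuple_measure_step A)%E.
Proof. by rewrite /tuple_measure_step /pushforward measure_ge0. Qed.

Let step_sigma_additive : semi_sigma_additive tuple_measure_step.
Proof.
rewrite /tuple_measure_step.
apply: measure_semi_sigma_additive; exact: measurable_tuple_cons.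
Qed.

HB.instance Definition _ := isMeasure.Build _ _ _ tuple_measure_step
  step0 step_ge0 step_sigma_additive.

Let step_sigma_finite : sigma_finite setT tuple_measure_step.
Proof.
apply: sigma_finite_pushforward_prod (@tuple_consK n).
exact: measurable_tuple_uncons.
Qed.

HB.instance Definition _ := Measure_isSigmaFinite.Build _ _ _
  tuple_measure_step step_sigma_finite.

End step.

(* the n-fold product measure m \x ... \x m *)
Fixpoint tuple_measure (n : nat) : {sigma_finite_measure set (n.-tuple T) -> \bar R} :=
  match n with
  | 0 => [the {sigma_finite_measure set (0.-tuple T) -> \bar R}
          of dirac ([tuple] : 0.-tuple T)]
  | k.+1 => [the {sigma_finite_measure set (k.+1.-tuple T) -> \bar R}
             of tuple_measure_step (tuple_measure k)]
  end.

End TupleMeasure.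

Definition borel_rV (R : realType) (n : nat) :=
  g_sigma_algebraType (@open 'rV[R]_n).

Section Volume.
Context {R : realType} (n : nat).

Definition row_of_tuple (t : n.-tuple (measurableTypeR R)) : borel_rV R n :=
  \row_i tnth t i.

Lemma measurable_row_of_tuple : measurable_fun setT row_of_tuple.
Proof.
have m_open : (measurable : set (set (borel_rV R n))) = <<s @open 'rV[R]_n >>.
  by [].
apply: (@measurability _ _ (n.-tuple (measurableTypeR R)) (borel_rV R n) setT
  row_of_tuple _ m_open) => _ [U oU <-]; rewrite setTI.
pose box (qk : 'rV[rat]_n * nat) : set 'rV[R]_n :=
  @ball R 'rV[R]_n (map_mx ratr qk.1) qk.2.+1%:R^-1.
have mbox qk : measurable (row_of_tuple @^-1` box qk).
  rewrite (_ : _ @^-1` _ = \bigcap_(i in [set: 'I_n])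
      (fun t => tnth t i) @^-1` ball (ratr (qk.1 ord0 i) : R) qk.2.+1%:R^-1).
    apply: fin_bigcap_measurable => // i _.
    rewrite -[X in measurable X]setTI; apply: measurable_tnth => //.
    by apply: open_measurable; exact: ball_open.
  apply/seteqP; split => [t [_ tb] i _|t tb] /=.
    by have := tb ord0 i; rewrite !mxE.
  split; first by rewrite invr_gt0.
  by move=> i j; rewrite !mxE ord1; exact: tb.
rewrite (_ : U = \bigcup_qk (if `[< box qk `<=` U >] then box qk else set0)).
  rewrite preimage_bigcup; apply: countable_bigcupT_measurable => // qk.
  by case: ifPn => _ //; rewrite preimage_set0.
apply/seteqP; split => [x Ux|x [qk _]]; last first.
  by case: ifPn => // /asboolP; exact.
have /nbhs_ballP[e /= e0 xeU] : nbhs x U by exact: open_nbhs_nbhs.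
have [k ke] : exists k : nat, k.+1%:R^-1 < e / 2.
  exists (Num.truncn (e / 2)^-1); rewrite invf_plt ?posrE ?divr_gt0//.
  exact: truncnS_gt.
have /choice[q qE] i : exists q : rat, `|x ord0 i - ratr q| < k.+1%:R^-1.
  have /rat_in_itvoo[q] : x ord0 i < x ord0 i + k.+1%:R^-1.
    by rewrite ltrDl invr_gt0.
  rewrite in_itv/= => /andP[xq qx]; exists q.
  by rewrite distrC gtr0_norm ?subr_gt0// ltrBlDl.
exists (\row_i q i, k) => //.
have xb : box (\row_i q i, k) x.
  split; first by rewrite invr_gt0.
  by move=> i j; rewrite !mxE ord1 /ball/= distrC; exact: qE.
case: ifPn => // /asboolP; elim => y yb; apply: xeU.
apply: (@le_ball _ _ _ (k.+1%:R^-1 + k.+1%:R^-1)).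
  by rewrite [leRHS](splitr e) lerD// ltW.
by apply: ball_triangle yb; exact: ball_sym.
Qed.

(* n-dimensional Lebesgue measure on the Borel sets of R^n *)
Definition volume : set (borel_rV R n) -> \bar R :=
  pushforward (tuple_measure lebesgue_measure n) row_of_tuple.

Let volume0 : volume set0 = 0%E.
Proof. by rewrite /volume /pushforward preimage_set0 measure0. Qed.

Let volume_ge0 A : (0 <= volume A)%E.
Proof. by rewrite /volume /pushforward measure_ge0. Qed.

Let volume_sigma_additive : semi_sigma_additive volume.
Proof.
rewrite /volume.
apply: measure_semi_sigma_additive; exact: measurable_row_of_tuple.
Qed.

HB.instance Definition _ := isMeasure.Build _ _ _ volume
  volume0 volume_ge0 volume_sigma_additive.

End Volume.
Arguments volume {R n}.

Section ConvexBodies.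
Context {R : realType} {n : nat}.
Local Notation E := 'rV[R]_n.
Implicit Types (K : set E) (x y : E).

(* The library norm `|x| on 'rV[R]_n is the sup norm; it induces the usual
   topology, but metric notions below go through [enorm]. *)
Definition dot x y : R := \sum_(i < n) x ord0 i * y ord0 i.

Definition enorm x : R := Num.sqrt (dot x x).

Definition convex_body K : Prop :=
  [/\ compact K, convex_set (K : set (convex_lmodType E)) & interior K !=set0].

Definition affine_map (f : E -> E) : Prop :=
  exists (T : 'M[R]_n) (b : E), forall x, f x = x *m T + b.

Definition volume_preserving (f : E -> E) : Prop :=
  forall B : set (borel_rV R n), measurable B -> volume (f @` B) = volume B.

Definition isotropic K (M : R) : Prop :=
  forall y,
    (\int[volume]_(x in (K : set (borel_rV R n))) (dot x y)%:E = 0)%E /\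
    (\int[volume]_(x in (K : set (borel_rV R n))) (dot x y ^+ 2)%:E
       = (M ^+ 2 * enorm y ^+ 2)%:E)%E.

Definition is_isotropy_constant K (L : R) : Prop :=
  exists (f : E -> E) (M : R),
    [/\ affine_map f, volume_preserving f, 0 < M, isotropic (f @` K) M &
        L = M / fine (volume K) `^ ((n + 2)%:R / (2 * n)%:R)].

(* L_K; the default value 0 is irrelevant, since a convex body has exactly one
   isotropy constant. *)
Definition isotropy_constant K : R := xget 0 [set L | is_isotropy_constant K L].

Definition hausdorff_dist K K' : R :=
  inf [set r | [/\ 0 <= r,
    forall x, K x -> exists2 y, K' y & enorm (x - y) <= r &
    forall y, K' y -> exists2 x, K x & enorm (x - y) <= r]].

Definition banach_mazur_dist K' K : R :=
  ln (inf [set l | 1 <= l /\ exists (x y : E) (T : 'M[R]_n),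
    [/\ T \in unitmx,
      [set k - x | k in K] `<=` [set (k' - y) *m T | k' in K'] &
      [set (k' - y) *m T | k' in K'] `<=` [set l *: (k - x) | k in K]]]).

Definition local_maximizer (d : set E -> set E -> R) K : Prop :=
  exists2 e : R, 0 < e &
    forall K', convex_body K' -> d K' K < e ->
      isotropy_constant K' <= isotropy_constant K.

Definition boundary K : set E := closure K `\` interior K.

Definition segment x y : set E :=
  [set (1 - t) *: x + t *: y | t in [set t : R | 0 <= t <= 1]].

Definition local_strict_convexity_point K x : Prop :=
  boundary K x /\
  ~ exists a b, [/\ a != b, segment a b `<=` boundary K & segment a b x].

End ConvexBodies.

(* Main.v *)
Require Import Defs.
From mathcomp Require Import all_boot all_order all_algebra.
From mathcomp Require Import all_classical all_reals all_analysis.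
From mathcomp Require Import measurable_realfun.
From mathcomp Require Import perm.
From mathcomp Require Import ring lra.

(** Write S for the inertia matrix of a body K about its centroid c and v for its
    volume. A Cholesky factorisation of S^-1 gives an isotropic position, and all
    isotropic positions have the same M_K ([isotropic_position_unique]), so that
    L_K^(2n) = det S / v^(n+2) ([isotropy_constantP]). In coordinates where S = 1
    let q be the squared distance to c and put r2 = (n+2)/v. A change of K by a set
    A of volume d changes log (det S / v^(n+2)) by the integral of q - r2 over A,
    with a sign minus if A is removed, up to an error C d^2
    ([isotropy_constant_lt], [isotropy_constant_add], [isotropy_constant_cut]). So
    mass should be added where q > r2 and removed where q < r2, and strict
    convexity allows both operations to be confined to a small neighbourhood of a
    point x0 of U.

    If q x0 > r2 for some x0 in U, replace K by the hull of K and a point y just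
    outside x0. The part added to K shrinks to x0 as y tends to x0, because the
    open segments from x0 to the other points of K are interior to K
    ([cone_near_strict_point]); there q - r2 is bounded below, and the gain is of
    order d against an error of order d^2 ([add_point_increases]).

    If q <= r2 on all of U, cut off a small cap at a point x1 of U where a
    hyperplane touches K at x1 only ([supporting_functional_near], [small_caps]).
    Now q - r2 may vanish on U, as when U lies on an ellipsoid, and the gain must
    be compared with d^2. Since the integral of q over K is n < r2 v, some
    interior point p has q p < r2, and convexity of q makes r2 - q at least
    k (1 - g) on the cap, with k = r2 - q p and g the gauge of K about p. The
    part of the cap where 1 - g < l has volume at most n l vol Q, with Q the cone
    from p over the cap; hence the gain is at least of order k d^2 / vol Q
    ([integ_gauge_lower]). As the cap shrinks, Q collapses to the segment from p
    to x1, and vol Q tends to 0 because n >= 2 ([thin_cone_small]). So the gain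
    exceeds C d^2 ([cut_cap_increases]).

    In both cases the new body and K contain copies of each other shrunk by a
    factor close to 1 about p, which makes them close in either distance
    ([not_local_maximizer]). *)

Set Implicit Arguments.
Unset Strict Implicit.
Unset Printing Implicit Defensive.

Import Order.TTheory GRing.Theory Num.Theory.
Import numFieldNormedType.Exports.

Local Open Scope classical_set_scope.
Local Open Scope ring_scope.

Ltac vec := apply/rowP => ?; rewrite !mxE; ring.

(** * Continuity and Borel measurability of maps between spaces of row vectors *)

Section BorelMaps.
Context {R : realType}.

Lemma open_measurable_rV n (U : set 'rV[R]_n) :
  open U -> measurable (U : set (borel_rV R n)).
Proof. by move=> oU; apply: sub_sigma_algebra. Qed.

Lemma closed_measurable_rV n (U : set 'rV[R]_n) :
  closed U -> measurable (U : set (borel_rV R n)).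
Proof.
move=> cU; rewrite -[U]setCK; apply: measurableC; apply: open_measurable_rV.
exact: closed_openC.
Qed.

Lemma compact_closed_rV n (U : set 'rV[R]_n) : compact U -> closed U.
Proof. by apply: compact_closed; exact: norm_hausdorff. Qed.

Lemma compact_measurable_rV n (U : set 'rV[R]_n) :
  compact U -> measurable (U : set (borel_rV R n)).
Proof. by move=> /compact_closed_rV; exact: closed_measurable_rV. Qed.

Lemma continuous_rV (T : topologicalType) n (f : T -> 'rV[R]_n) :
  (forall j, continuous (fun x => f x ord0 j)) -> continuous f.
Proof.
move=> cf x A [P nP PA]; rewrite nbhs_filterE.
have : \forall y \near x, forall j, P ord0 j (f y ord0 j).
  by apply: filter_forall => j; apply: cf; exact: nP.
by apply: filterS => y Py; apply: PA => i j; rewrite ord1.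
Qed.

Section RealContinuity.
Context {T : topologicalType}.
Implicit Types f g : T -> R.

Lemma cont_add f g : continuous f -> continuous g ->
  continuous (fun x => f x + g x).
Proof. by move=> cf cg x; exact: (continuousD (cf x) (cg x)). Qed.

Lemma cont_sub f g : continuous f -> continuous g ->
  continuous (fun x => f x - g x).
Proof. by move=> cf cg x; exact: (continuousB (cf x) (cg x)). Qed.

Lemma cont_mul f g : continuous f -> continuous g ->
  continuous (fun x => f x * g x).
Proof. by move=> cf cg x; exact: (continuousM (cf x) (cg x)). Qed.

Lemma cont_cst (a : R) : continuous (fun _ : T => a).
Proof. exact: cst_continuous. Qed.

Lemma cont_sum (I : Type) (r : seq I) (P : pred I) (f : I -> T -> R) :
  (forall i, continuous (f i)) -> continuous (fun x => \sum_(i <- r | P i) f i x).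
Proof.
move=> cf; elim: r => [|i r IH].
  by under eq_fun do rewrite big_nil; exact: cont_cst.
under eq_fun do rewrite big_cons; case: (P i) => //.
by apply: cont_add => //; exact: cf.
Qed.

End RealContinuity.

Lemma cont_coord n (j : 'I_n) : continuous (fun x : 'rV[R]_n => x ord0 j).
Proof. exact: coord_continuous. Qed.

Lemma cont_normB n (x0 : 'rV[R]_n) : continuous (fun x : 'rV[R]_n => `|x - x0|).
Proof.
move=> x; apply: (@continuous_comp _ _ _ (fun x : 'rV[R]_n => x - x0) (fun x => `|x|)).
  move: x; apply: continuous_rV => j; under eq_fun do rewrite !mxE.
  by apply: cont_sub; [exact: cont_coord|exact: cont_cst].
exact: norm_continuous.
Qed.

Lemma cont_line n (x v : 'rV[R]_n) : continuous (fun t : R => x + t *: v).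
Proof.
apply: continuous_rV => j; under eq_fun do rewrite !mxE.
apply: cont_add; first exact: cont_cst.
by apply: cont_mul; [move=> t|exact: cont_cst].
Qed.

Lemma open_line n (O : set 'rV[R]_n) (x v : 'rV[R]_n) : open O -> O x ->
  exists t : R, 0 < t <= 1 /\ O (x + t *: v).
Proof.
move=> oO Ox; have : \forall t \near (0 : R), O (x + t *: v).
  apply: cont_line; rewrite scale0r addr0; exact: open_nbhs_nbhs.
move=> /nbhs_ballP[e /= e0 he]; exists (Num.min (e / 2) 1).
have e20 : 0 < e / 2 by rewrite divr_gt0.
rewrite lt_min e20 ltr01 ge_min lexx orbT; split => //; apply: he.
rewrite /ball /= sub0r normrN gtr0_norm; last by rewrite lt_min e20 ltr01.
by rewrite gt_min ltr_pdivrMr// ltr_pMr// ltr1n.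
Qed.

Section LevelSets.
Context {T : topologicalType} (f : T -> R) (a : R).
Hypothesis cf : continuous f.

Lemma closed_sublevel : closed [set x | f x <= a].
Proof. by apply: (preimage_closed (D := [set t | t <= a])) => [x _|]; [exact: cf|exact: closed_le]. Qed.

Lemma closed_superlevel : closed [set x | a <= f x].
Proof. by apply: (preimage_closed (D := [set t | a <= t])) => [x _|]; [exact: cf|exact: closed_ge]. Qed.

Lemma open_sublevel : open [set x | f x < a].
Proof. by apply: (open_comp (D := [set t | t < a])) => [x _|]; [exact: cf|exact: open_lt]. Qed.

Lemma open_superlevel : open [set x | a < f x].
Proof. by apply: (open_comp (D := [set t | a < t])) => [x _|]; [exact: cf|exact: open_gt]. Qed.

End LevelSets.

Lemma continuous_measurable_rV m n (f : 'rV[R]_m -> 'rV[R]_n) :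
  continuous f -> measurable_fun setT (f : borel_rV R m -> borel_rV R n).
Proof.
move=> cf.
have m_open : (measurable : set (set (borel_rV R n))) = <<s @open 'rV[R]_n >>.
  by [].
apply: (@measurability _ _ (borel_rV R m) (borel_rV R n) setT f _ m_open).
move=> _ [U oU <-]; rewrite setTI; apply: open_measurable_rV.
by apply: open_comp => // x _; exact: cf.
Qed.

Lemma continuous_measurable_real n (f : 'rV[R]_n -> R) :
  continuous f -> measurable_fun setT (f : borel_rV R n -> measurableTypeR R).
Proof.
move=> cf; apply: (measurability _ (RGenOpens.measurableE R)).
move=> _ [_ [a [b ->]] <-]; rewrite setTI; apply: open_measurable_rV.
apply: open_comp => [x _|]; [exact: cf|exact: interval_open].
Qed.

End BorelMaps.

(** * Volume under triangular affine maps *)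

Section VolumeS.
Context {R : realType}.

Definition row_cons n (x : R) (y : 'rV[R]_n) : 'rV[R]_n.+1 :=
  row_mx (x%:M : 'rV[R]_1) y.

Definition section_rV n (B : set 'rV[R]_n.+1) (x : R) : set (borel_rV R n) :=
  [set y | B (row_cons x y)].

Lemma row_cons0 n x (y : 'rV[R]_n) : row_cons x y ord0 ord0 = x.
Proof.
rewrite /row_cons (_ : ord0 = lshift n ord0 :> 'I_(1 + n)); last exact: val_inj.
by rewrite (row_mxEl (x%:M) y) mxE eqxx mulr1n.
Qed.

Lemma row_consS n x (y : 'rV[R]_n) k : row_cons x y ord0 (lift ord0 k) = y ord0 k.
Proof.
rewrite /row_cons (_ : lift ord0 k = rshift 1 k :> 'I_(1 + n)); last exact: val_inj.
by rewrite (row_mxEr (x%:M) y).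
Qed.

Let row_of_tuple_cons n x (t : n.-tuple (measurableTypeR R)) :
  row_of_tuple (tuple_cons (x, t)) = row_cons x (row_of_tuple t).
Proof.
apply/rowP => i; case: (unliftP ord0 i) => [k|] ->.
  by rewrite row_consS !mxE tnthS.
by rewrite row_cons0 !mxE tnth0.
Qed.

Let section_rVE n (B : set 'rV[R]_n.+1) x :
  (fun t => section_rV B x (row_of_tuple t)) =
  xsection ((fun p => B (row_of_tuple (tuple_cons p)))) x.
Proof.
by apply/seteqP; split => t; rewrite /xsection /= inE row_of_tuple_cons.
Qed.

(** Fubini for the first coordinate: the volumes of cubes and of preimages under
    triangular maps are computed by induction on the dimension through it. *)
Lemma volumeS n (B : set (borel_rV R n.+1)) : measurable B ->
  volume B = (\int[lebesgue_measure]_x volume (section_rV B x))%E.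
Proof.
move=> mB; rewrite {1}/volume /pushforward /= /tuple_measure_step /pushforward/=.
rewrite /product_measure1; apply: eq_integral => x _ /=.
rewrite /volume /pushforward; congr (tuple_measure _ _ _); exact: (esym (section_rVE B x)).
Qed.

Lemma measurable_volume_section n (B : set (borel_rV R n.+1)) : measurable B ->
  measurable_fun setT (fun x : measurableTypeR R => volume (section_rV B x)).
Proof.
move=> mB.
have mB' : measurable ((fun p : measurableTypeR R * n.-tuple (measurableTypeR R) =>
    B (row_of_tuple (tuple_cons p)))).
  have := measurable_row_of_tuple measurableT mB; rewrite setTI => mB1.
  by have := measurable_tuple_cons measurableT mB1; rewrite setTI.
have := measurable_fun_xsection (tuple_measure lebesgue_measure n) mB'.
apply: eq_measurable_fun => x _ /=.
rewrite /volume /pushforward; congr (tuple_measure _ _ _); exact: (esym (section_rVE B x)).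
Qed.

Lemma measurable_section n (B : set (borel_rV R n.+1)) x : measurable B ->
  measurable (section_rV B x).
Proof.
move=> mB; rewrite -[section_rV B x]setTI.
apply: (@continuous_measurable_rV R n n.+1 (row_cons x)) => //.
apply: continuous_rV => j; case: (unliftP ord0 j) => [k|] ->.
  under eq_fun do rewrite row_consS; exact: coord_continuous.
under eq_fun do rewrite row_cons0; exact: cst_continuous.
Qed.

End VolumeS.

Section AffineVolume.
Context {R : realType}.

Lemma lebesgue_measure_affine (a b : R) (A : set (measurableTypeR R)) :
  0 < a -> measurable A ->
  lebesgue_measure A = (a%:E * lebesgue_measure ((fun x => a * x + b)%R @^-1` A))%E.
Proof.
move=> a0 mA.
have mf : measurable_fun setT (fun x : measurableTypeR R => a * x + b : measurableTypeR R).
  by apply: measurable_funD => //; exact: measurable_funM.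
pose mu' := mscale (NngNum (ltW a0)) (pushforward lebesgue_measure (fun x : measurableTypeR R => a * x + b : measurableTypeR R)).
suff E : forall X, ocitv X -> lebesgue_measure X = mu' mf X.
  exact: (@lebesgue_measure_unique R (mu' mf) E).
move=> _ [[c d]] _ <- /=.
rewrite /mu' /mscale /= /pushforward.
rewrite (_ : _ @^-1` _ = `]((c - b) / a), ((d - b) / a)]%classic); last first.
  apply/seteqP; split => x /=; rewrite !in_itv/= ltr_pdivrMr// ler_pdivlMr// ltrBlDr lerBrDr mulrC//.
rewrite !lebesgue_measure_itv/= !lte_fin.
rewrite ltr_pM2r ?invr_gt0// ltrD2r; case: ifPn => cd; last by rewrite mule0.
rewrite -EFinM; congr EFin; field; exact: lt0r_neq0.
Qed.

Lemma ge0_integral_affine (a b : R) (f : measurableTypeR R -> \bar R) : 0 < a ->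
  measurable_fun setT f -> (forall x, 0 <= f x)%E ->
  (\int[lebesgue_measure]_x f x = a%:E * \int[lebesgue_measure]_x f (a * x + b)%R)%E.
Proof.
move=> a0 mf f0.
have mg : measurable_fun setT (fun x : measurableTypeR R => a * x + b : measurableTypeR R).
  by apply: measurable_funD => //; exact: measurable_funM.
have -> : (\int[lebesgue_measure]_x f (a * x + b)%R)%E =
   (\int[pushforward lebesgue_measure (fun x : measurableTypeR R => (a * x + b)%R : measurableTypeR R)]_x f x)%E.
  by rewrite ge0_integral_pushforward.
rewrite -(ge0_integral_mscale _ measurableT (NngNum (ltW a0)))//.
by apply: eq_measure_integral => A mA _ /=; exact: lebesgue_measure_affine.
Qed.

End AffineVolume.

Section TriangularVolume.
Context {R : realType}.

Definition affine m n (T : 'M[R]_(m, n)) (b : 'rV[R]_n) (x : 'rV[R]_m) := x *m T + b.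

Lemma continuous_affine_rV m n (T : 'M[R]_(m, n)) (b : 'rV[R]_n) :
  continuous (affine T b).
Proof.
apply: continuous_rV => j; rewrite /affine.
under eq_fun do rewrite !mxE.
apply: cont_add; last exact: cont_cst.
by apply: cont_sum => i; apply: cont_mul; [exact: cont_coord|exact: cont_cst].
Qed.

Lemma measurable_affine_preimage m n (T : 'M[R]_(m, n)) (b : 'rV[R]_n)
    (B : set (borel_rV R n)) : measurable B ->
  measurable (affine T b @^-1` B : set (borel_rV R m)).
Proof.
move=> mB; rewrite -[X in measurable X]setTI.
by apply: (continuous_measurable_rV (@continuous_affine_rV _ _ T b)).
Qed.

Definition upper_triangular n (T : 'M[R]_n) :=
  forall i j : 'I_n, (j < i)%N -> T i j = 0.

(** For fixed first coordinate the map acts on the others by an affine map with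
    a smaller triangular matrix, and it acts on the first coordinate alone; so
    Fubini reduces the change of variables to dimension one. Triangular maps are
    enough here because Cholesky factors put a body in isotropic position. *)
Lemma volume_triangular n (T : 'M[R]_n) (b : 'rV[R]_n) (B : set (borel_rV R n)) :
  upper_triangular T -> (forall i, 0 < T i i) -> measurable B ->
  volume B = ((\prod_i T i i)%:E *
              volume ((affine T b @^-1` B : set (borel_rV R n))))%E.
Proof.
elim: n => [|n IH] in T b B *.
  move=> _ _ mB; rewrite big_ord0 mul1e; congr volume.
  by apply/funext => x /=; congr B; apply/rowP => -[].
move=> triT T0 mB.
pose T' : 'M[R]_n := \matrix_(i, j) T (lift ord0 i) (lift ord0 j).
pose b' (x : R) : 'rV[R]_n := \row_j (x * T ord0 (lift ord0 j) + b ord0 (lift ord0 j)).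
have affE x y : affine T b (row_cons x y) =
    row_cons (T ord0 ord0 * x + b ord0 ord0) (affine T' (b' x) y).
  apply/rowP => j; rewrite [LHS]mxE [X in X + _]mxE big_ord_recl row_cons0.
  case: (unliftP ord0 j) => [k|] ->.
    rewrite row_consS [RHS]mxE [X in _ = X + _]mxE [X in _ = _ + X]mxE.
    rewrite addrAC addrC; congr (_ + _).
    by apply: eq_bigr => i _; rewrite row_consS mxE.
  rewrite row_cons0 big1 ?addr0 1?mulrC// => i _.
  by rewrite triT ?mulr0.
have sE x : section_rV (affine T b @^-1` B) x =
   affine T' (b' x) @^-1` section_rV B (T ord0 ord0 * x + b ord0 ord0).
  by apply/funext => y; rewrite /section_rV /= affE.
have mP : measurable (affine T b @^-1` B : set (borel_rV R n.+1)).
  exact: measurable_affine_preimage.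
rewrite volumeS// (ge0_integral_affine (b ord0 ord0) (T0 ord0)); last 2 first.
  exact: (measurable_volume_section mB).
  by move=> x; exact: (measure_ge0 (@volume R n)).
rewrite big_ord_recl EFinM -muleA; congr (_ * _)%E.
rewrite volumeS// -ge0_integralZl//; last 2 first.
- exact: measurable_volume_section.
- by rewrite lee_fin prodr_ge0// => i _; exact: ltW.
apply: eq_integral => x _; rewrite sE.
rewrite (IH T' (b' x)).
- by congr (_ * _)%E; congr EFin; apply: eq_bigr => i _; rewrite mxE.
- by move=> i j ij; rewrite mxE triT.
- by move=> i; rewrite mxE.
- exact: measurable_section.
Qed.

End TriangularVolume.

(** * Cubes, homotheties and bounded Borel sets *)

Section Cubes.
Context {R : realType}.

Definition cube n (r : R) : set (borel_rV R n) := [set x : 'rV[R]_n | forall i, `|x ord0 i| <= r].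

Arguments cube : clear implicits.

Lemma cubeE n (r : R) : 0 <= r -> cube n r = [set x : 'rV[R]_n | `|x| <= r].
Proof.
move=> r0; apply/seteqP; split => x /= xr.
  by rewrite [leLHS]mx_normrE; apply/bigmax_leP; split => // -[i j] _ /=; rewrite ord1; exact: xr.
move=> i; apply: le_trans xr; rewrite [leRHS]mx_normrE.
exact: (le_bigmax _ (fun ij => `|x ij.1 ij.2|) (ord0, i)).
Qed.

Lemma coord_le_norm n (x : 'rV[R]_n) i : `|x ord0 i| <= `|x|.
Proof. by have : cube n `|x| x by rewrite cubeE/=; exact. Qed.

Lemma closed_cube n (r : R) : 0 <= r -> closed (cube n r : set 'rV[R]_n).
Proof.
move=> r0; rewrite cubeE//; apply: closed_sublevel => x; exact: norm_continuous.
Qed.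

Lemma measurable_cube n (r : R) : 0 <= r -> measurable (cube n r).
Proof. by move=> r0; apply: closed_measurable_rV; exact: closed_cube. Qed.

Lemma volume_cube n (r : R) : 0 <= r -> volume (cube n r) = ((r *+ 2) ^+ n)%:E.
Proof.
move=> r0; elim: n => [|n IH].
  by rewrite expr0 /volume /pushforward /= diracE mem_set//; case.
rewrite volumeS; last exact: measurable_cube.
transitivity (\int[lebesgue_measure]_(x in `[(- r)%R, r]) ((r *+ 2) ^+ n)%R%:E)%E.
  rewrite [RHS]integral_mkcond; apply: eq_integral => x _; rewrite patchE.
  have sE : section_rV (cube n.+1 r) x = [set y | `|x| <= r /\ cube n r y].
    apply/seteqP; split => y /=.
      move=> h; split; first by have := h ord0; rewrite row_cons0.
      by move=> i; have := h (lift ord0 i); rewrite row_consS.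
    move=> [xr yr] i; case: (unliftP ord0 i) => [k|] ->; rewrite ?row_cons0 ?row_consS//.
  rewrite sE; case: ifPn => [|].
    rewrite inE/= in_itv/= -ler_norml => xr; rewrite -IH; congr volume.
    by apply/seteqP; split => y /= => [[]|].
  rewrite notin_setE/= in_itv/= -ler_norml => xr.
  rewrite (_ : [set y | _] = set0) ?measure0//.
  by apply/seteqP; split => y // -[].
rewrite integral_cst//= lebesgue_measure_itv/= lte_fin.
case: ifPn => [_|]; first by rewrite -EFinD -EFinM opprK -mulr2n -exprSr.
rewrite -leNgt => rr; have -> : r = 0 by lra.
by rewrite mule0 mul0rn expr0n.
Qed.

Lemma volume_bounded n (A : set (borel_rV R n)) (r : R) : measurable A ->
  (forall x : 'rV[R]_n, A x -> `|x| <= r) -> (volume A < +oo)%E.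
Proof.
move=> mA Ar; apply: (@le_lt_trans _ _ (volume (cube n `|r|))).
  apply: le_measure; rewrite ?inE//; first exact: measurable_cube.
  by rewrite cubeE// => x /Ar /= xr; rewrite (le_trans xr)// ler_norm.
by rewrite volume_cube// ltry.
Qed.

Lemma upper_triangular_scalar n (a : R) : upper_triangular (a%:M : 'M[R]_n).
Proof.
by move=> i j ij; rewrite mxE (_ : i == j = false) ?mulr0n//; apply/eqP => ji; rewrite ji ltnn in ij.
Qed.

Lemma volume_homothety n (a : R) (b : 'rV[R]_n) (B : set (borel_rV R n)) :
  0 < a -> measurable B ->
  volume B = ((a ^+ n)%:E *
    volume ((fun x : 'rV[R]_n => (a *: x + b)%R) @^-1` B : set (borel_rV R n)))%E.
Proof.
move=> a0 mB; rewrite (@volume_triangular R n a%:M b)//; first last.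
- by move=> i; rewrite mxE eqxx.
- exact: upper_triangular_scalar.
under eq_bigr do rewrite mxE eqxx mulr1n.
rewrite prodr_const card_ord; congr (_ * volume _)%E.
by apply/funext => x; rewrite /affine /= mul_mx_scalar.
Qed.

Lemma volume_open_gt0 n (A : set 'rV[R]_n) : open A -> A !=set0 ->
  (0 < volume A)%E.
Proof.
move=> oA [x Ax].
have /nbhs_ballP[e /= e0 eA] : nbhs x A by exact: open_nbhs_nbhs.
pose T : 'rV[R]_n -> 'rV[R]_n := fun y => 1 *: y + x.
apply: (@lt_le_trans _ _ (volume (cube n (e / 2)))).
  rewrite volume_cube ?divr_ge0 ?ltW// lte_fin exprn_gt0// pmulrn_rgt0// divr_gt0//.
rewrite [leRHS](@volume_homothety n 1 x)//; last exact: open_measurable_rV.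
rewrite expr1n mul1e; apply: le_measure; rewrite ?inE//.
- by apply: measurable_cube; rewrite divr_ge0 ?ltW.
- have := measurable_affine_preimage (1%:M) x (open_measurable_rV oA).
  by congr measurable; apply/funext => y; rewrite /= /affine mul_mx_scalar.
rewrite cubeE ?divr_ge0 ?ltW// => y /= ye; apply: eA.
rewrite -ball_normE /= scale1r opprD addrCA subrr addr0 normrN.
by apply: le_lt_trans ye _; lra.
Qed.

End Cubes.
Arguments cube {R} n r.

Section BoundedBorel.
Context {R : realType} {n : nat}.
Implicit Types (A B : set (borel_rV R n)) (f g : 'rV[R]_n -> R).

Definition bounded_borel A :=
  measurable A /\ exists r, forall x : 'rV[R]_n, A x -> `|x| <= r.

Definition integ A f : R := \int[volume]_(x in A) f x.

Definition vol A : R := fine (volume A).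

Lemma bounded_borel_sub A B : bounded_borel B -> measurable A -> A `<=` B -> bounded_borel A.
Proof. by move=> [_ [r Br]] mA AB; split => //; exists r => x /AB; exact: Br. Qed.

Lemma compact_bounded_borel (A : set 'rV[R]_n) : compact A -> bounded_borel A.
Proof.
move=> cA; split; first exact: compact_measurable_rV.
have [M [_ h]] := compact_bounded cA.
by exists (M + 1) => x Ax; apply: h => //; rewrite ltrDl.
Qed.

Lemma continuous_bounded_on A f : bounded_borel A -> continuous f ->
  exists2 M, 0 <= M & forall x, A x -> `|f x| <= M.
Proof.
move=> [_ [r Ar]] cf.
have cpt : compact (cube n `|r| : set 'rV[R]_n).
  apply: bounded_closed_compact; last exact: closed_cube.
  exists `|r|; split => // M rM x; rewrite cubeE//= => /le_trans; apply; exact: ltW.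
have : compact (f @` (cube n `|r| : set 'rV[R]_n)).
  by apply: continuous_compact => //; apply: continuous_subspaceT.
move=> /compact_bounded [M [_ h]].
exists (`|M| + 1) => // x Ax; apply: h; first by rewrite (le_lt_trans (ler_norm _))// ltrDl.
by exists x => //; rewrite cubeE//= (le_trans (Ar _ Ax))// ler_norm.
Qed.

Lemma bounded_borel_fin A : bounded_borel A -> (volume A < +oo)%E.
Proof. by move=> [mA [r Ar]]; exact: volume_bounded Ar. Qed.

Lemma bounded_borel_fin_num A : bounded_borel A -> volume A \is a fin_num.
Proof. by move=> bA; rewrite ge0_fin_numE ?measure_ge0//; exact: bounded_borel_fin. Qed.

Lemma continuous_integrable A f : bounded_borel A -> continuous f ->
  volume.-integrable A (EFin \o f).
Proof.
move=> bA cf; have [mA _] := bA.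
apply: measurable_bounded_integrable => //.
- exact: bounded_borel_fin.
- by apply: measurable_funTS; exact: continuous_measurable_real.
- have [M M0 h] := continuous_bounded_on bA cf.
  exists M; split; first exact: num_real.
  by move=> x Mx y Ay; apply: le_trans (h _ Ay) _; exact: ltW.
Qed.

Lemma integ_EFin A f : bounded_borel A -> continuous f ->
  (\int[volume]_(x in A) (f x)%:E)%E = (integ A f)%:E.
Proof.
move=> bA cf; rewrite /integ /Rintegral fineK//.
apply: integrable_fin_num; first by case: bA.
exact: continuous_integrable.
Qed.

Lemma eq_integ A f g : (forall x, A x -> f x = g x) -> integ A f = integ A g.
Proof. by move=> fg; apply: eq_Rintegral => x; rewrite inE; exact: fg. Qed.

Lemma integ_cst A (c : R) : bounded_borel A -> integ A (fun=> c) = c * vol A.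
Proof. by move=> [mA _]; exact: Rintegral_cst. Qed.

Lemma integD A f g : bounded_borel A -> continuous f -> continuous g ->
  integ A (fun x => f x + g x) = integ A f + integ A g.
Proof.
by move=> bA cf cg; apply: RintegralD; [by case: bA| |]; exact: continuous_integrable.
Qed.

Lemma integB A f g : bounded_borel A -> continuous f -> continuous g ->
  integ A (fun x => f x - g x) = integ A f - integ A g.
Proof.
by move=> bA cf cg; apply: RintegralB; [by case: bA| |]; exact: continuous_integrable.
Qed.

Lemma integZ A (c : R) f : bounded_borel A -> continuous f ->
  integ A (fun x => c * f x) = c * integ A f.
Proof.
by move=> bA cf; apply: RintegralZl; [by case: bA|]; exact: continuous_integrable.
Qed.

Lemma integ_sum A (I : Type) (r : seq I) (f : I -> 'rV[R]_n -> R) :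
  bounded_borel A -> (forall i, continuous (f i)) ->
  integ A (fun x => \sum_(i <- r) f i x) = \sum_(i <- r) integ A (f i).
Proof.
move=> bA cf; elim: r => [|i r IH].
  rewrite big_nil -[RHS](mul0r (vol A)) -integ_cst//; apply: eq_integ => x _.
  by rewrite big_nil.
rewrite big_cons -IH -integD//; last exact: cont_sum.
by apply: eq_integ => x _; rewrite big_cons.
Qed.

Lemma le_integ A f g : bounded_borel A -> continuous f -> continuous g ->
  (forall x, A x -> f x <= g x) -> integ A f <= integ A g.
Proof.
by move=> bA cf cg fg; apply: le_Rintegral => //; [by case: bA| |]; exact: continuous_integrable.
Qed.

Lemma integ_ge0 A f : (forall x, A x -> 0 <= f x) -> 0 <= integ A f.
Proof. by move=> f0; exact: Rintegral_ge0. Qed.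

Lemma le_norm_integ A f (M : R) : bounded_borel A -> continuous f ->
  (forall x, A x -> `|f x| <= M) -> `|integ A f| <= M * vol A.
Proof.
move=> bA cf fM; rewrite -integ_cst//.
rewrite ler_norml -[X in - X]mul1r -mulNr -integZ//; last exact: cont_cst.
apply/andP; split; apply: le_integ => //.
- by apply: cont_mul; exact: cont_cst.
- by move=> x /fM; rewrite mulN1r ler_norml => /andP[].
- exact: cont_cst.
- by move=> x /fM; rewrite ler_norml => /andP[].
Qed.

Lemma integ_setU A B f : bounded_borel A -> bounded_borel B -> continuous f ->
  A `&` B = set0 -> integ (A `|` B) f = integ A f + integ B f.
Proof.
move=> [mA [r Ar]] [mB [r' Br]] cf AB; apply: Rintegral_setU => //.
  apply: continuous_integrable => //; split; first exact: measurableU.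
  exists (Num.max r r') => x [/Ar|/Br] h; rewrite le_max h ?orbT//.
exact/disj_set2P.
Qed.

Lemma integ_setD A B f : bounded_borel A -> measurable B -> B `<=` A -> continuous f ->
  integ (A `\` B) f = integ A f - integ B f.
Proof.
move=> bA mB BA cf; have [mA _] := bA.
rewrite -{2}(setDUK BA) integ_setU//; first by ring.
- exact: bounded_borel_sub bA mB BA.
- apply: bounded_borel_sub bA _ _; first exact: measurableD.
  exact: subDsetl.
- by rewrite setDIK.
Qed.

Lemma volE A : bounded_borel A -> vol A = integ A (fun=> 1).
Proof. by move=> bA; rewrite integ_cst// mul1r. Qed.

Lemma vol_ge0 A : 0 <= vol A.
Proof. by rewrite fine_ge0// measure_ge0. Qed.

Lemma le_vol A B : measurable A -> bounded_borel B -> A `<=` B -> vol A <= vol B.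
Proof.
move=> mA bB AB; have [mB _] := bB; apply: fine_le.
- exact: bounded_borel_fin_num (bounded_borel_sub bB mA AB).
- exact: bounded_borel_fin_num.
- by apply: le_measure; rewrite ?inE.
Qed.

Lemma vol_open_gt0 (O : set 'rV[R]_n) A : open O -> O !=set0 -> O `<=` A ->
  bounded_borel A -> 0 < vol A.
Proof.
move=> oO O0 OA bA; have mO := open_measurable_rV oO.
apply: (@lt_le_trans _ _ (vol O)); last exact: le_vol.
rewrite fine_gt0// volume_open_gt0//=.
exact/bounded_borel_fin/(bounded_borel_sub bA).
Qed.

End BoundedBorel.

(** * Cholesky factorisation and expansions of the determinant *)

Section Cholesky.
Context {R : realType}.

(** Let (s, w) be the first row of S and S' the block of the other rows and
    columns. Gaussian elimination replaces S' by the Schur complement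
    S' - w^T w / s, which is again positive definite: its quadratic form at u is
    the minimum over x of the form of S at (x, u). *)
Lemma cholesky n (S : 'M[R]_n) : S^T = S ->
  (forall u : 'rV[R]_n, u != 0 -> 0 < (u *m S *m u^T) ord0 ord0) ->
  exists T : 'M[R]_n, [/\ upper_triangular T, forall i, 0 < T i i &
    T^T *m S *m T = 1%:M].
Proof.
elim: n => [|n IH] in S *.
  by move=> _ _; exists 1%:M; split; [case|case|apply/matrixP; case].
rewrite -[n.+1]/(1 + n)%N in S *.
move=> symS posS.
pose s := S ord0 ord0; pose w := ursubmx S; pose S' := drsubmx S.
have ES : S = block_mx s%:M w w^T S'.
  rewrite -{1}(submxK S); congr block_mx.
    by apply/matrixP => i j; rewrite !ord1 !mxE /s !mulr1n; congr (S _ _); exact: val_inj.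
  by rewrite /w trmx_ursub symS.
have symS' : S'^T = S' by rewrite /S' trmx_drsub symS.
have quad (x : R) (u : 'rV[R]_n) :
  (row_mx x%:M u *m S *m (row_mx x%:M u)^T) ord0 ord0 =
   s * x ^+ 2 + x * ((w *m u^T) ord0 ord0) *+ 2 + (u *m S' *m u^T) ord0 ord0.
  rewrite ES mul_row_block tr_row_mx mul_row_col !mulmxDl !mul_scalar_mx tr_scalar_mx.
  rewrite !mul_mx_scalar -!scalemxAl.
  have -> : u *m w^T = (w *m u^T)^T by rewrite trmx_mul trmxK.
  move: (w *m u^T) (u *m S' *m u^T) => A C.
  by rewrite !mxE !eqxx !mulr1n; ring.
have s0 : 0 < s.
  have := posS (row_mx 1%:M 0); rewrite quad trmx0 !mulmx0 mxE mulr0 mul0rn expr1n.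
  rewrite mulr1 !addr0; apply; apply/eqP => /(congr1 (fun M => lsubmx M)).
  by rewrite row_mxKl => /matrixP/(_ ord0 ord0); rewrite !mxE => /eqP; rewrite oner_eq0.
pose S2 := S' - s^-1 *: (w^T *m w).
have [||T' [triT' T'0 T'E]] := IH S2.
- by rewrite /S2 linearB /= symS' linearZ /= trmx_mul trmxK.
- move=> u u0; pose q := (w *m u^T) ord0 ord0.
  have := posS (row_mx (- (q / s))%:M u); rewrite quad -/q => h.
  have -> : (u *m S2 *m u^T) ord0 ord0 = (u *m S' *m u^T) ord0 ord0 - q ^+ 2 / s.
    rewrite mulmxBr mulmxBl mxE [X in _ + X]mxE; congr (_ - _).
    rewrite -scalemxAr -scalemxAl mxE mulrC.
    have -> : u *m (w^T *m w) *m u^T = (w *m u^T)^T *m (w *m u^T).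
      by rewrite trmx_mul trmxK !mulmxA.
    by congr (_ / _); rewrite mxE big_ord1 mxE expr2.
  have := h _; have -> : s * (- (q / s)) ^+ 2 + - (q / s) * q *+ 2 = - (q ^+ 2 / s).
    by field; exact: lt0r_neq0.
  rewrite addrC; apply; apply/eqP => /(congr1 (fun M => rsubmx M)).
  by rewrite row_mxKr linear0; exact/eqP.
pose a := (Num.sqrt s)^-1.
have a0 : 0 < a by rewrite invr_gt0 sqrtr_gt0.
have a2 : a * a * s = 1.
  by rewrite /a -invfM -expr2 sqr_sqrtr ?ltW// mulVf// lt0r_neq0.
pose c := - s^-1 *: (w *m T').
exists (block_mx a%:M c 0 T'); split.
- move=> i j; case: (split_ordP i) => k ->; case: (split_ordP j) => l -> ji.
  + by rewrite !ord1 ltnn in ji.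
  + by move: ji; rewrite ord1 /= add1n.
  + by rewrite block_mxEdl mxE.
  + by rewrite block_mxEdr triT'//; move: ji; rewrite /= !add1n ltnS.
- move=> i; case: (split_ordP i) => k ->; first by rewrite block_mxEul ord1 mxE eqxx.
  by rewrite block_mxEdr.
have Z : s *: c + w *m T' = 0.
  by rewrite /c scalerA mulrN mulfV ?lt0r_neq0// scaleN1r addNr.
have Zt : c^T *m s%:M + T'^T *m w^T = 0.
  by rewrite mul_mx_scalar -linearZ -trmx_mul -linearD /= Z trmx0.
rewrite ES tr_block_mx !mulmx_block !tr_scalar_mx trmx0 !mul0mx !mulmx0 !addr0.
rewrite !Zt !mul0mx !add0r.
have -> : a%:M *m s%:M *m a%:M = 1%:M :> 'M[R]_1.
  by rewrite -!scalar_mxM mulrAC a2.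
have -> : a%:M *m s%:M *m c + a%:M *m w *m T' = 0.
  by rewrite -!mulmxA -mulmxDr (mul_scalar_mx s) Z mulmx0.
have -> : (c^T *m w + T'^T *m S') *m T' = 1%:M.
  rewrite -T'E /S2 mulmxBr !mulmxBl mulmxDl addrC; congr (_ + _).
  rewrite /c linearZ /= trmx_mul scaleNr mulNmx mulNmx; congr (- _).
  by rewrite -scalemxAr -!scalemxAl !mulmxA.
by rewrite -scalar_mx_block.
Qed.

End Cholesky.

Section DetExpansion.
Context {R : realType}.

Lemma prod1D_expansion n : exists2 c : R, 0 <= c &
  forall (f : 'I_n -> R) (e : R), 0 <= e <= 1 -> (forall i, `|f i| <= e) ->
  `|\prod_i (1 + f i) - 1 - \sum_i f i| <= c * e ^+ 2.
Proof.
elim: n => [|n [c c0 IH]].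
  exists 0 => // f e _ _; rewrite !big_ord0 subrr subr0 normr0 mul0r//.
exists (c *+ 2 + n%:R); first by rewrite addr_ge0 ?mulrn_wge0.
move=> f e /andP[e0 e1] fe; rewrite !big_ord_recl.
set P := \prod_(i < n) _; set Q := \sum_(i < n) _.
have h : `|P - 1 - Q| <= c * e ^+ 2.
  by apply: IH => [|i]; [rewrite e0|exact: fe].
have Qe : `|Q| <= n%:R * e.
  apply: le_trans (ler_norm_sum _ _ _) _.
  apply: (@le_trans _ _ (\sum_(i < n) e)); first by apply: ler_sum => i _; exact: fe.
  by rewrite sumr_const card_ord mulr_natl.
have fe0 := fe ord0.
have -> : (1 + f ord0) * P - 1 - (f ord0 + Q) =
  (P - 1 - Q) + f ord0 * (P - 1 - Q) + f ord0 * Q by ring.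
have ce0 : 0 <= c * e ^+ 2 by rewrite mulr_ge0// exprn_ge0.
have h1 : `|f ord0 * (P - 1 - Q)| <= c * e ^+ 2.
  rewrite normrM -[leRHS]mul1r; apply: ler_pM => //; exact: le_trans e1.
have h2 : `|f ord0 * Q| <= n%:R * e ^+ 2.
  by rewrite normrM expr2 mulrCA; apply: ler_pM.
apply: le_trans (ler_normD _ _) _.
rewrite mulrDl; apply: lerD => //.
by apply: le_trans (ler_normD _ _) _; rewrite mulrnAl mulr2n; exact: lerD.
Qed.

Lemma prod_two_small n (g : 'I_n -> R) (e : R) (i j : 'I_n) : i != j ->
  0 <= e -> (forall k, `|g k| <= 2) -> `|g i| <= e -> `|g j| <= e ->
  `|\prod_k g k| <= 2 ^+ n * e ^+ 2.
Proof.
move=> ij e0 g2 gi gj; rewrite normr_prod (bigD1 i)//= (bigD1 j)/=; last first.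
  by rewrite eq_sym ij.
rewrite mulrA mulrC; apply: ler_pM => //.
- by apply: prodr_ge0 => k _.
- apply: (@le_trans _ _ (\prod_(k < n | (k != i) && (k != j)) 2)).
    by apply: ler_prod => k _; rewrite normr_ge0 g2.
  rewrite prodr_const; apply: ler_weXn2l; first by lra.
  by rewrite -[X in (_ <= X)%N](card_ord n); exact: max_card.
- by rewrite expr2; apply: ler_pM.
Qed.

(** In the Leibniz formula the identity contributes a product of 1 + E i i, and
    every other permutation moves at least two indices, hence contributes at
    least two off-diagonal entries. *)
Lemma det1D_expansion n : exists2 c : R, 0 <= c &
  forall (E : 'M[R]_n) (e : R), 0 <= e <= 1 -> (forall i j, `|E i j| <= e) ->
  `|\det (1%:M + E) - 1 - \tr E| <= c * e ^+ 2.
Proof.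
have [c c0 hc] := prod1D_expansion n.
exists (c + #|{: {perm 'I_n}}|%:R * 2 ^+ n).
  by rewrite addr_ge0// mulr_ge0// exprn_ge0.
move=> E e /andP[e0 e1] Ee.
rewrite /determinant (bigD1 (1%g : {perm 'I_n}))//= odd_perm1 expr0 mul1r.
have -> : \prod_i (1%:M + E) i ((1%g : {perm 'I_n}) i) = \prod_i (1 + E i i).
  by apply: eq_bigr => i _; rewrite perm1 !mxE eqxx.
have h1 : `|\prod_i (1 + E i i) - 1 - \tr E| <= c * e ^+ 2.
  by apply: hc => //; rewrite e0.
rewrite -addrA addrAC -addrA addrA [X in `|X + _|]addrA.
apply: le_trans (ler_normD _ _) _; rewrite mulrDl; apply: lerD => //.
apply: le_trans (ler_norm_sum _ _ _) _.
apply: (@le_trans _ _ (\sum_(s : {perm 'I_n} | s != 1%g) 2 ^+ n * e ^+ 2)).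
  apply: ler_sum => s s1; rewrite normrM normrX normrN1 expr1n mul1r.
  have [i si] : exists i, s i != i.
    apply/existsP; apply: contraNT s1; rewrite negb_exists => /forallP h.
    by apply/eqP/permP => i; rewrite perm1; apply/eqP; have := h i; rewrite negbK.
  have small k : s k != k -> `|(1%:M + E) k (s k)| <= e.
    by move=> sk; rewrite !mxE eq_sym (negbTE sk) add0r.
  apply: (@prod_two_small _ (fun k => (1%:M + E) k (s k)) e i (s i)) => //.
  - by rewrite eq_sym.
  - move=> k; have [sk|sk] := eqVneq (s k) k; last by apply: le_trans (small k sk) _; lra.
    rewrite sk !mxE eqxx; apply: le_trans (ler_normD _ _) _; rewrite normr1.
    by have := Ee k k; lra.
  - exact: small.
  - by apply: small; apply/eqP => /perm_inj/eqP; exact/negP.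
rewrite sumr_const -[leLHS]mulr_natl mulrA; apply: ler_wpM2r; first exact: exprn_ge0.
apply: ler_wpM2r; first exact: exprn_ge0.
by rewrite ler_nat; exact: max_card.
Qed.

Lemma expr1D_upper n : exists2 c : R, 0 <= c &
  forall s : R, `|s| <= 1 -> (1 + s) ^+ n <= 1 + n%:R * s + c * s ^+ 2.
Proof.
have [c c0 h] := prod1D_expansion n; exists c => // s s1.
have := h (fun=> s) `|s|; rewrite normr_ge0 s1 => /(_ isT (fun _ => lexx _)).
rewrite prodr_const sumr_const card_ord -mulr_natl real_normK ?num_real//.
by move=> /(le_trans (ler_norm _)); lra.
Qed.

(** The isotropy constant is governed by det S / vol^(n+2), with S the inertia
    matrix. In coordinates where S = 1, this bounds from below its value when the
    volume changes by s, the first moments by a and the second moments by G, all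
    of order d: the linear term is tr G - (n+2) s / v, and C d^2 dominates the
    remainders, among them the displacement of the centroid. *)
Lemma normalized_det_gain n (v B : R) : 0 < v -> 0 <= B ->
  exists2 C : R, 0 < C &
  forall (d s : R) (a : 'rV[R]_n) (G : 'M[R]_n),
    0 <= d -> C * d <= 1 -> `|s| <= d ->
    (forall i, `|a ord0 i| <= B * d) -> (forall i j, `|G i j| <= B * d) ->
    C * d ^+ 2 < \tr G - (n + 2)%:R / v * s ->
    0 < v + s /\
    (v + s) ^+ (n + 2) < \det (1%:M + G - (v + s)^-1 *: (a^T *m a)) * v ^+ (n + 2).
Proof.
move=> v0 B0; have [c c0 hdet] := det1D_expansion n.
have [c' c'0 hexp] := expr1D_upper (n + 2).
pose B1 := B + 2 * B ^+ 2 / v.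
have B10 : 0 <= B1 by rewrite addr_ge0// divr_ge0 ?(ltW v0)// mulr_ge0// exprn_ge0.
pose C2 := n%:R * (2 * B ^+ 2 / v) + c * B1 ^+ 2 + c' / v ^+ 2.
have q0 : 0 <= 2 * B ^+ 2 / v by rewrite divr_ge0 ?(ltW v0)// mulr_ge0// exprn_ge0.
have C20 : 0 <= C2.
  apply: addr_ge0; last by rewrite divr_ge0// exprn_ge0// ltW.
  by apply: addr_ge0; apply: mulr_ge0 => //; exact: exprn_ge0.
have iv0 : 0 < v^-1 by rewrite invr_gt0.
exists (1 + 2 / v + B1 + C2); first by lra.
move=> d s a G d0 Cd sd ad Gd gain.
have d20 : 0 <= d ^+ 2 by exact: exprn_ge0.
have dv : d <= v / 2.
  have : (2 / v) * d <= 1.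
    apply: le_trans Cd; apply: ler_wpM2r => //; lra.
  by rewrite mulrAC ler_pdivrMr//; lra.
have d1 : d <= 1 by apply: le_trans Cd; rewrite -{1}[d]mul1r; apply: ler_wpM2r => //; lra.
have Bd1 : B1 * d <= 1 by apply: le_trans Cd; apply: ler_wpM2r => //; lra.
have {}gain : C2 * d ^+ 2 < \tr G - (n + 2)%:R / v * s.
  by apply: le_lt_trans gain; apply: ler_wpM2r => //; lra.
have /andP[sd1 sd2] : - d <= s <= d by rewrite -ler_norml.
have vs0 : v / 2 <= v + s by lra.
have vsp : 0 < v + s by lra.
split => //.
have ivs : (v + s)^-1 <= 2 / v.
  by rewrite -[2 / v]invrK invf_div lef_pV2// posrE//; lra.
pose A := (v + s)^-1 *: (a^T *m a).
have Ae i j : `|A i j| <= (2 * B ^+ 2 / v) * d ^+ 2.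
  rewrite /A !mxE big_ord1 !mxE !normrM (gtr0_norm (_ : 0 < (v + s)^-1)) ?invr_gt0//.
  have -> : 2 * B ^+ 2 / v * d ^+ 2 = (2 / v) * ((B * d) * (B * d)) by ring.
  apply: ler_pM => //; first by rewrite invr_ge0 ltW.
  by apply: ler_pM.
have dd : d ^+ 2 <= d by rewrite expr2 -[leRHS]mul1r; apply: ler_wpM2r.
have Ee i j : `|(G - A) i j| <= B1 * d.
  have -> : (G - A) i j = G i j - A i j by rewrite !mxE.
  apply: le_trans (ler_normB _ _) _; rewrite /B1 mulrDl.
  apply: lerD => //; apply: le_trans (Ae i j) _.
  exact: ler_wpM2l.
have := hdet (G - A) (B1 * d); rewrite mulr_ge0// Bd1 => /(_ isT Ee).
rewrite ler_norml => /andP[+ _].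
have trA : \tr A <= n%:R * (2 * B ^+ 2 / v) * d ^+ 2.
  apply: (@le_trans _ _ (\sum_(i < n) (2 * B ^+ 2 / v) * d ^+ 2)).
    by apply: ler_sum => i _; exact: le_trans (ler_norm _) (Ae i i).
  by rewrite sumr_const card_ord -[leLHS]mulr_natl mulrA.
rewrite addrA linearB /= exprMn mulrA => hd.
have sv1 : `|s / v| <= 1.
  by rewrite normrM (gtr0_norm iv0) ler_pdivrMr// mul1r; lra.
have := hexp (s / v) sv1 => he.
have -> : (v + s) ^+ (n + 2) = (1 + s / v) ^+ (n + 2) * v ^+ (n + 2).
  by rewrite -exprMn mulrDl mul1r divfK// lt0r_neq0.
rewrite ltr_pM2r ?exprn_gt0//.
apply: le_lt_trans he _.
have s2 : c' * (s / v) ^+ 2 <= c' / v ^+ 2 * d ^+ 2.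
  rewrite exprMn exprVn -mulrA (mulrC (v ^+ 2)^-1); apply: ler_wpM2l => //.
  apply: ler_wpM2r; first by rewrite invr_ge0 exprn_ge0// ltW.
  by rewrite -(real_normK (num_real s)) lerXn2r ?nnegrE.
have e1 : (n + 2)%:R / v * s = (n + 2)%:R * (s / v) by ring.
move: gain; rewrite e1 /C2 !mulrDl => gain.
lra.
Qed.

End DetExpansion.

(** * Inertia matrix and whitening coordinates *)

Section Inertia.
Context {R : realType} {n : nat}.
Implicit Types (K : set (borel_rV R n)) (x y u : 'rV[R]_n) (T : 'M[R]_n).

Lemma dotE x y : dot x y = (x *m y^T) ord0 ord0.
Proof. by rewrite mxE; apply: eq_bigr => i _; rewrite mxE. Qed.

Lemma dotC x y : dot x y = dot y x.
Proof. by apply: eq_bigr => i _; rewrite mulrC. Qed.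

Lemma dotDl x y u : dot (x + y) u = dot x u + dot y u.
Proof. by rewrite !dotE mulmxDl mxE. Qed.

Lemma dotBl x y u : dot (x - y) u = dot x u - dot y u.
Proof. by rewrite !dotE mulmxBl !mxE. Qed.

Lemma dotZl a x u : dot (a *: x) u = a * dot x u.
Proof. by rewrite !dotE -scalemxAl mxE. Qed.

Lemma dotBr x y u : dot u (x - y) = dot u x - dot u y.
Proof. by rewrite !(dotC u) dotBl. Qed.

Lemma dotZr a x u : dot u (a *: x) = a * dot u x.
Proof. by rewrite !(dotC u) dotZl. Qed.

Lemma dotMl x y T : dot (x *m T) y = dot x (y *m T^T).
Proof. by rewrite !dotE trmx_mul trmxK mulmxA. Qed.

Lemma dot_ge0 x : 0 <= dot x x.
Proof. by apply: sumr_ge0 => i _; rewrite -expr2 sqr_ge0. Qed.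

Lemma dot_eq0 x : (dot x x == 0) = (x == 0).
Proof.
apply/idP/idP => [|/eqP ->]; last by rewrite /dot big1// => i _; rewrite mxE mul0r.
rewrite psumr_eq0 => [|i _]; last by rewrite -expr2 sqr_ge0.
move=> /allP h; apply/eqP/rowP => i; rewrite mxE; apply/eqP.
by have := h i; rewrite mem_index_enum => /(_ isT)/=; rewrite mulf_eq0 orbb.
Qed.

Lemma dot_gt0 x : (0 < dot x x) = (x != 0).
Proof. by rewrite lt_def dot_eq0 dot_ge0 andbT. Qed.

Lemma enorm2 x : enorm x ^+ 2 = dot x x.
Proof. by rewrite sqr_sqrtr// dot_ge0. Qed.

Lemma cont_dot (U : topologicalType) (f g : U -> 'rV[R]_n) :
  continuous f -> continuous g -> continuous (fun z => dot (f z) (g z)).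
Proof.
move=> cf cg; rewrite /dot; apply: cont_sum => i; apply: cont_mul => z.
  exact: (@continuous_comp _ _ _ f (fun y : 'rV[R]_n => y ord0 i) z (cf z) (@cont_coord R n i (f z))).
exact: (@continuous_comp _ _ _ g (fun y : 'rV[R]_n => y ord0 i) z (cg z) (@cont_coord R n i (g z))).
Qed.

Lemma cont_dotr u : continuous (fun x => dot x u).
Proof.
by apply: cont_sum => i; apply: cont_mul; [exact: cont_coord|exact: cont_cst].
Qed.

Lemma cont_dot_affine p u : continuous (fun x => dot (x - p) u).
Proof.
by under eq_fun do rewrite dotBl; apply: cont_sub; [exact: cont_dotr|exact: cont_cst].
Qed.

Lemma cont_sqdist p : continuous (fun x => dot (x - p) (x - p)).
Proof.
by apply: cont_dot; apply: continuous_rV => j; under eq_fun do rewrite !mxE;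
  apply: cont_sub; [exact: cont_coord|exact: cont_cst|exact: cont_coord|exact: cont_cst].
Qed.

Lemma norm_le_dot x (r : R) : 0 <= r -> dot x x <= r ^+ 2 -> `|x| <= r.
Proof.
move=> r0 xr; have : cube n r x; last by rewrite cubeE.
move=> i; rewrite -ler_sqr ?nnegrE// real_normK ?num_real//; apply: le_trans xr.
rewrite /dot (bigD1 i)//= -expr2 lerDl; apply: sumr_ge0 => j _.
by rewrite -expr2 sqr_ge0.
Qed.

Lemma dot_le_norm x : dot x x <= n%:R * `|x| ^+ 2.
Proof.
apply: (@le_trans _ _ (\sum_(i < n) `|x| ^+ 2)).
  apply: ler_sum => i _; rewrite -expr2 -(real_normK (num_real (x ord0 i))).
  by rewrite lerXn2r ?nnegrE// coord_le_norm.
by rewrite sumr_const card_ord mulr_natl.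
Qed.

Definition centroid K : 'rV[R]_n := \row_i (integ K (fun x => x ord0 i) / vol K).

Definition inertia K : 'M[R]_n := \matrix_(i, j)
  integ K (fun x => (x ord0 i - centroid K ord0 i) * (x ord0 j - centroid K ord0 j)).

Lemma integ_dot K p u : bounded_borel K -> 0 < vol K ->
  integ K (fun x => dot (x - p) u) = vol K * dot (centroid K - p) u.
Proof.
move=> bK v0; under eq_fun do rewrite dotBl.
rewrite integB//; [|exact: cont_dotr|exact: cont_cst].
rewrite integ_cst// integ_sum//; last first.
  by move=> i; apply: cont_mul; [exact: cont_coord|exact: cont_cst].
rewrite dotBl mulrBr [X in _ - X]mulrC; congr (_ - _).
rewrite mulr_sumr; apply: eq_bigr => i _; under eq_fun do rewrite mulrC.
rewrite integZ//; last exact: cont_coord.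
by rewrite mxE; field; exact: lt0r_neq0.
Qed.

Lemma integ_dot_dot K u u' : bounded_borel K -> 0 < vol K ->
  integ K (fun x => dot (x - centroid K) u * dot (x - centroid K) u') =
  (u *m inertia K *m u'^T) ord0 ord0.
Proof.
move=> bK v0; set c := centroid K.
have cc (i : 'I_n) : continuous (fun x => x ord0 i - c ord0 i).
  by apply: cont_sub; [exact: cont_coord|exact: cont_cst].
transitivity (integ K (fun x => \sum_j \sum_i (u ord0 i * u' ord0 j) *
    ((x ord0 i - c ord0 i) * (x ord0 j - c ord0 j)))).
  apply: eq_integ => x _; rewrite /dot mulr_sumr; apply: eq_bigr => j _.
  by rewrite mulr_suml; apply: eq_bigr => i _; rewrite !mxE; ring.
rewrite integ_sum//; last first.
  move=> j; apply: cont_sum => i; apply: cont_mul; first exact: cont_cst.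
  by apply: cont_mul; exact: cc.
rewrite [RHS]mxE; apply: eq_bigr => j _; rewrite integ_sum//; last first.
  move=> i; apply: cont_mul; first exact: cont_cst.
  by apply: cont_mul; exact: cc.
rewrite [X in X * _]mxE mulr_suml; apply: eq_bigr => i _; rewrite integZ//.
  by rewrite !mxE; ring.
by apply: cont_mul; exact: cc.
Qed.

Lemma inertia_sym K : (inertia K)^T = inertia K.
Proof. by apply/matrixP => i j; rewrite !mxE; under eq_fun do rewrite mulrC. Qed.

(** When T^T S T = 1 for the inertia matrix S of K and p is its centroid, these
    coordinates whiten K: they have mean zero and identity second moments. *)
Definition acoord T p (i : 'I_n) x : R := ((x - p) *m T) ord0 i.

Lemma acoordE T p i x : acoord T p i x = dot (x - p) (row i T^T).
Proof. by rewrite /acoord mxE /dot; apply: eq_bigr => k _; rewrite !mxE. Qed.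

Lemma cont_acoord T p i : continuous (acoord T p i).
Proof.
have -> : acoord T p i = (fun x => dot (x - p) (row i T^T)).
  by apply/funext => x; exact: acoordE.
exact: cont_dot_affine.
Qed.

(** Huygens-Steiner: second moments may be taken about any point p, once the
    displacement of the centroid is corrected for. A perturbed body is thus
    compared with K in the coordinates centred at the centroid of K. *)
Lemma inertia_congr K T p i j : bounded_borel K -> 0 < vol K ->
  (T^T *m inertia K *m T) i j =
  integ K (fun x => acoord T p i x * acoord T p j x) -
  (vol K)^-1 * (integ K (acoord T p i) * integ K (acoord T p j)).
Proof.
move=> bK v0; pose u := row i T^T; pose u' := row j T^T.
have -> : (T^T *m inertia K *m T) i j = (u *m inertia K *m u'^T) ord0 ord0.
  rewrite /u /u' tr_row trmxK colE mulmxA -colE -!row_mul.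
  by rewrite [RHS]mxE [RHS]mxE.
rewrite -integ_dot_dot//.
have cu a : continuous (fun x => dot (x - centroid K) a) by exact: cont_dot_affine.
have cE k x : acoord T p k x =
    dot (x - centroid K) (row k T^T) + dot (centroid K - p) (row k T^T).
  by rewrite acoordE -dotDl subrKA.
have IE k : integ K (acoord T p k) = vol K * dot (centroid K - p) (row k T^T).
  by rewrite -integ_dot//; apply: eq_integ => x _; rewrite acoordE.
rewrite !IE.
set a := dot (centroid K - p) _; set b := dot (centroid K - p) _.
have Z v : integ K (fun x => dot (x - centroid K) v) = 0.
  by rewrite integ_dot// subrr /dot big1 ?mulr0// => k _; rewrite mxE mul0r.
transitivity (integ K (fun x => dot (x - centroid K) u * dot (x - centroid K) u' +
    (b * dot (x - centroid K) u + (a * dot (x - centroid K) u' + a * b))) - a * b * vol K); last first.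
  congr (_ - _); first by apply: eq_integ => x _; rewrite !cE -/a -/b -/u -/u'; ring.
  by field; exact: lt0r_neq0.
have cm k v : continuous (fun x => k * dot (x - centroid K) v).
  by apply: cont_mul; [exact: cont_cst|exact: cu].
have c1 : continuous (fun x => a * dot (x - centroid K) u' + a * b).
  by apply: cont_add; [exact: cm|exact: cont_cst].
have c2 : continuous (fun x => dot (x - centroid K) u * dot (x - centroid K) u').
  by apply: cont_mul; exact: cu.
have c3 : continuous (fun x => b * dot (x - centroid K) u +
    (a * dot (x - centroid K) u' + a * b)) by apply: cont_add => //; exact: cm.
rewrite (integD bK c2 c3) (integD bK (cm b u) c1) (integD bK (cm a u') (@cont_cst _ _ _)).
rewrite (integZ b bK (cu u)) (integZ a bK (cu u')) integ_cst// !Z; ring.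
Qed.

End Inertia.

(** * Isotropic positions and the isotropy constant *)

Section IsotropyConstant.
Context {R : realType} {n : nat}.
Implicit Types (K : set 'rV[R]_n) (x y u b : 'rV[R]_n) (T : 'M[R]_n).

Lemma body_bounded K : convex_body K -> bounded_borel K.
Proof. by case=> cK _ _; exact: compact_bounded_borel. Qed.

Lemma body_vol_gt0 K : convex_body K -> 0 < vol K.
Proof.
move=> bK; have [_ _ K0] := bK.
apply: (vol_open_gt0 (open_interior K) K0); first exact: interior_subset.
exact: body_bounded.
Qed.

(** The form of the inertia matrix at u is the integral over K of the square of
    a nonconstant affine function, which is positive on an open part of K. *)
Lemma inertia_pos K u : convex_body K -> u != 0 ->
  0 < (u *m inertia K *m u^T) ord0 ord0.
Proof.
move=> bK u0; have bbK := body_bounded bK; have v0 := body_vol_gt0 bK.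
rewrite -integ_dot_dot//; set c := centroid _.
have cf : continuous (fun x => dot (x - c) u * dot (x - c) u).
  by apply: cont_mul; exact: cont_dot_affine.
have [_ _ [x0 x0K]] := bK.
have [x1 [x1K x1u]] : exists x, interior K x /\ 0 < dot (x - c) u * dot (x - c) u.
  have [E|E] := eqVneq (dot (x0 - c) u) 0; last first.
    by exists x0; split => //; rewrite -expr2 exprn_even_gt0.
  have [t [/andP[t0 _] tK]] := open_line u (@open_interior _ K) x0K.
  exists (x0 + t *: u); split => //.
  have -> : x0 + t *: u - c = (x0 - c) + t *: u by rewrite addrAC.
  rewrite dotDl E add0r dotZl -expr2 exprn_even_gt0//=.
  by rewrite mulf_neq0 ?dot_eq0// lt0r_neq0.
set m := dot (x1 - c) u * dot (x1 - c) u in x1u.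
pose O := interior K `&` [set x | m / 2 < dot (x - c) u * dot (x - c) u].
have oO : open O.
  apply: openI; first exact: open_interior.
  exact: open_superlevel.
have OK : O `<=` K by move=> x [/interior_subset].
have bO : bounded_borel O.
  by apply: bounded_borel_sub bbK _ OK; exact: open_measurable_rV.
have mO := open_measurable_rV oO.
apply: (@lt_le_trans _ _ (integ O (fun=> m / 2))).
  rewrite integ_cst// mulr_gt0//; first by lra.
  apply: (vol_open_gt0 oO) => //; exists x1; split => //=.
  by rewrite -/m; lra.
apply: (@le_trans _ _ (integ O (fun x => dot (x - c) u * dot (x - c) u))).
  apply: le_integ => //; first exact: cont_cst.
  by move=> x [_ /ltW].
rewrite -subr_ge0 -integ_setD//.
by apply: integ_ge0 => x _; rewrite -expr2 sqr_ge0.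
Qed.

Lemma affineK T b : T \in unitmx ->
  cancel (affine T b) (affine (invmx T) (- (b *m invmx T))).
Proof.
by move=> uT x; rewrite /affine mulmxDl mulmxK// addrK.
Qed.

Lemma affineVK T b : T \in unitmx ->
  cancel (affine (invmx T) (- (b *m invmx T))) (affine T b).
Proof.
by move=> uT x; rewrite /affine mulmxDl mulmxKV// mulNmx mulmxKV// subrK.
Qed.

Lemma image_affine T b (B : set 'rV[R]_n) : T \in unitmx ->
  affine T b @` B = affine (invmx T) (- (b *m invmx T)) @^-1` B.
Proof.
move=> uT; apply/seteqP; split => [_ [x Bx <-]/=|y /= By].
  by rewrite affineK.
by exists (affine (invmx T) (- (b *m invmx T)) y) => //; exact: affineVK.
Qed.

Lemma preimage_image_affine T b (B : set 'rV[R]_n) : T \in unitmx ->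
  affine T b @^-1` (affine T b @` B) = B.
Proof.
move=> uT; rewrite image_affine//; apply/seteqP; split => x /=; by rewrite affineK.
Qed.

Lemma measurable_image_affine T b (B : set (borel_rV R n)) : T \in unitmx ->
  measurable B -> measurable (affine T b @` B : set (borel_rV R n)).
Proof. by move=> uT mB; rewrite image_affine//; exact: measurable_affine_preimage. Qed.

Lemma integ_image T b (A : set (borel_rV R n)) (g : 'rV[R]_n -> R) : T \in unitmx ->
  volume_preserving (affine T b) -> bounded_borel A -> continuous g ->
  integ (affine T b @` A) g = integ A (g \o affine T b).
Proof.
move=> uT vp bA cg; have [mA _] := bA; set f := affine T b.
have cf : continuous f by exact: continuous_affine_rV.
have mf : measurable_fun setT (f : borel_rV R n -> borel_rV R n).
  exact: continuous_measurable_rV.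
rewrite /integ /Rintegral; congr fine.
transitivity (\int[pushforward volume (f : borel_rV R n -> borel_rV R n)]_(x in f @` A) (g x)%:E)%E.
  apply: eq_measure_integral => B mB _; rewrite /pushforward /=.
  have mfB : measurable (f @^-1` B : set (borel_rV R n)) by exact: measurable_affine_preimage.
  have E : f @` (f @^-1` B) = B.
    rewrite image_preimage//; apply/seteqP; split => // y _.
    by exists (affine (invmx T) (- (b *m invmx T)) y) => //; exact: affineVK.
  by have := vp _ mfB; rewrite E => ->.
rewrite integral_pushforward//; last 3 first.
- by apply/measurable_EFinP; exact: continuous_measurable_real.
- rewrite preimage_image_affine//.
  by apply: (@continuous_integrable _ _ A (g \o f)) => // x; apply: continuous_comp; [exact: cf|exact: cg].
- exact: measurable_image_affine.
by rewrite preimage_image_affine.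
Qed.

End IsotropyConstant.

Section IsotropicPosition.
Context {R : realType} {n : nat}.
Implicit Types (K : set 'rV[R]_n) (x y u b : 'rV[R]_n) (T : 'M[R]_n) (M L : R).

Lemma sym_quad_eq0 (P : 'M[R]_n) : P^T = P ->
  (forall y, (y *m P *m y^T) ord0 ord0 = 0) -> P = 0.
Proof.
move=> symP h; have bil x y : (x *m P *m y^T) ord0 ord0 = 0.
  have := h (x + y); rewrite linearD /= !mulmxDl !mulmxDr mxE [X in X + _]mxE.
  rewrite [X in _ + X]mxE !h add0r addr0.
  have -> : y *m P *m x^T = (x *m P *m y^T)^T by rewrite !trmx_mul trmxK symP mulmxA.
  by rewrite [X in _ + X]mxE => E; lra.
apply/matrixP => i j; have := bil (delta_mx ord0 i) (delta_mx ord0 j).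
by rewrite trmx_delta -colE -rowE !mxE.
Qed.

Lemma compact_affine K T b : compact K -> compact (affine T b @` K).
Proof.
move=> cK; apply: continuous_compact => //; apply: continuous_subspaceT.
exact: continuous_affine_rV.
Qed.

(** A singular map would make some linear functional constant on the image,
    hence zero by the first moment, which contradicts the second moment. *)
Lemma isotropic_unitmx K T b M : convex_body K -> volume_preserving (affine T b) ->
  0 < M -> isotropic (affine T b @` K) M -> T \in unitmx.
Proof.
move=> bK vp M0 iso; rewrite -unitmx_tr -row_free_unit -kermx_eq0.
apply: contraT => /rowV0Pn[y /sub_kermxP yT y0].
have bfK : bounded_borel (affine T b @` K).
  by apply: compact_bounded_borel; apply: compact_affine; case: bK.
have fy x : (affine T b @` K) x -> dot x y = dot b y.
  by move=> [z _ <-]; rewrite /affine dotDl dotMl yT [X in X + _]dotE trmx0 mulmx0 mxE add0r.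
have [iso1 iso2] := iso y.
have vfK : volume (affine T b @` K) = volume K.
  by apply: vp; exact: (body_bounded bK).1.
have by0 : dot b y = 0.
  move: iso1; rewrite integ_EFin//; last exact: cont_dotr.
  rewrite (eq_integ fy) integ_cst// /vol vfK => -[/eqP].
  by rewrite mulf_eq0 => /orP[/eqP//|/eqP E]; have := body_vol_gt0 bK; rewrite /vol E ltxx.
have cd : continuous (fun x => dot x y ^+ 2).
  by under eq_fun do rewrite expr2; apply: cont_mul; exact: cont_dotr.
move: iso2; rewrite integ_EFin//.
rewrite (@eq_integ _ _ _ _ (fun=> 0)); last by move=> x /fy ->; rewrite by0 expr0n.
rewrite integ_cst// mul0r enorm2 => -[/esym/eqP].
by rewrite mulf_eq0 expf_eq0/= gt_eqF//= dot_eq0 (negbTE y0).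
Qed.

Lemma isotropic_inertia K T b M : convex_body K -> volume_preserving (affine T b) ->
  0 < M -> isotropic (affine T b @` K) M ->
  T^T *m inertia K *m T = (M ^+ 2)%:M.
Proof.
move=> bK vp M0 iso; have uT := isotropic_unitmx bK vp M0 iso.
have bbK := body_bounded bK; have v0 := body_vol_gt0 bK.
have bfK : bounded_borel (affine T b @` K).
  by apply: compact_bounded_borel; apply: compact_affine; case: bK.
have cd y : continuous (fun x => dot x y ^+ 2).
  by under eq_fun do rewrite expr2; apply: cont_mul; exact: cont_dotr.
pose p := - (b *m invmx T).
have fE x y : dot (affine T b x) y = dot (x - p) (y *m T^T).
  by rewrite -dotMl /affine /p opprK mulmxDl mulmxKV.
have cp : centroid K = p.
  have [+ _] := iso ((centroid K - p) *m invmx T^T).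
  rewrite integ_EFin//; last exact: cont_dotr.
  rewrite integ_image//; last exact: cont_dotr.
  rewrite (@eq_integ _ _ _ _ (fun x => dot (x - p) (centroid K - p))); last first.
    by move=> x _; rewrite /= fE mulmxKV// unitmx_tr.
  rewrite integ_dot// => -[/eqP].
  by rewrite mulf_eq0 gt_eqF//= dot_eq0 subr_eq0 => /eqP.
apply/eqP; rewrite -subr_eq0; apply/eqP; apply: sym_quad_eq0.
  by rewrite linearB /= !trmx_mul trmxK inertia_sym tr_scalar_mx mulmxA.
move=> y; have [_ ] := iso y.
rewrite integ_EFin// integ_image//.
rewrite (@eq_integ _ _ _ _ (fun x => dot (x - centroid K) (y *m T^T) *
   dot (x - centroid K) (y *m T^T))); last first.
  by move=> x _; rewrite /= fE cp expr2.
rewrite integ_dot_dot// trmx_mul trmxK enorm2 dotE => -[E].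
rewrite !mulmxA in E.
rewrite mulmxBr mulmxBl !mulmxA mul_mx_scalar -scalemxAl mxE E.
by rewrite [X in _ + X = _]mxE [X in _ - X = _]mxE subrr.
Qed.

Lemma inertia_isotropic K T b M : convex_body K -> volume_preserving (affine T b) ->
  T \in unitmx -> affine T b (centroid K) = 0 ->
  T^T *m inertia K *m T = (M ^+ 2)%:M ->
  isotropic (affine T b @` K) M.
Proof.
move=> bK vp uT fc E y.
have bbK := body_bounded bK; have v0 := body_vol_gt0 bK.
have bfK : bounded_borel (affine T b @` K).
  by apply: compact_bounded_borel; apply: compact_affine; case: bK.
have cd : continuous (fun x => dot x y ^+ 2).
  by under eq_fun do rewrite expr2; apply: cont_mul; exact: cont_dotr.
set c := centroid _ in fc.
have fE x : dot (affine T b x) y = dot (x - c) (y *m T^T).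
  by rewrite -dotMl -[affine T b x]subr0 -fc /affine mulmxBl opprD addrACA subrr addr0.
split.
  rewrite integ_EFin//; last exact: cont_dotr.
  rewrite integ_image//; last exact: cont_dotr.
  rewrite (@eq_integ _ _ _ _ (fun x => dot (x - c) (y *m T^T))); last by move=> x _; exact: fE.
  by rewrite integ_dot// subrr dotE mul0mx mxE mulr0.
rewrite integ_EFin// integ_image//.
rewrite (@eq_integ _ _ _ _ (fun x => dot (x - c) (y *m T^T) * dot (x - c) (y *m T^T))); last first.
  by move=> x _; rewrite /= fE expr2.
rewrite integ_dot_dot// trmx_mul trmxK enorm2 dotE; congr EFin.
rewrite -!mulmxA [T^T *m _]mulmxA (mulmxA (T^T *m _)) E.
by rewrite mul_scalar_mx -scalemxAr mxE.
Qed.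

Let ball1 : set (borel_rV R n) := [set x : 'rV[R]_n | dot x x <= 1].

Let closed_ball1 : closed (ball1 : set 'rV[R]_n).
Proof.
by apply: closed_sublevel; apply: (@cont_dot R n _ id id) => z.
Qed.

Let bounded_ball1 : bounded_borel ball1.
Proof.
split; first exact: closed_measurable_rV.
by exists 1 => x /= x1; apply: norm_le_dot; rewrite ?expr1n.
Qed.

Let vol_ball1 : 0 < vol ball1.
Proof.
pose O := [set x : 'rV[R]_n | dot x x < 1].
apply: (@vol_open_gt0 _ _ O) => //.
- by apply: open_sublevel; apply: (@cont_dot R n _ id id) => z.
- by exists 0; rewrite /O /= dotE mul0mx mxE.
- by move=> x /ltW.
Qed.

(** Two isotropic positions differ by an affine map that multiplies lengths by
    l = M2 / M1. It preserves volume and sends the unit ball to a ball of radius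
    l, so l = 1; this avoids computing the volume distortion of a general
    linear map. *)
Lemma isotropic_position_unique (S T1 T2 : 'M[R]_n) b1 b2 M1 M2 : (0 < n)%N ->
  volume_preserving (affine T1 b1) -> volume_preserving (affine T2 b2) ->
  0 < M1 -> 0 < M2 -> T1 \in unitmx -> T2 \in unitmx ->
  T1^T *m S *m T1 = (M1 ^+ 2)%:M -> T2^T *m S *m T2 = (M2 ^+ 2)%:M -> M1 = M2.
Proof.
move=> n0 vp1 vp2 M10 M20 u1 u2 E1 E2.
pose Q := invmx T1 *m T2; pose l := M2 / M1.
have l0 : 0 < l by rewrite divr_gt0.
have QtQ : Q^T *m Q = (l ^+ 2)%:M.
  have ET : T2 = T1 *m Q by rewrite /Q mulKVmx.
  have : M1 ^+ 2 *: (Q^T *m Q) = (M2 ^+ 2)%:M.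
    rewrite -E2 ET.
    have -> : (T1 *m Q)^T *m S *m (T1 *m Q) = Q^T *m (T1^T *m S *m T1) *m Q.
      by rewrite trmx_mul !mulmxA.
    rewrite E1.
    by rewrite mul_mx_scalar -scalemxAl.
  move=> /(congr1 (fun A => (M1 ^+ 2)^-1 *: A)).
  rewrite scalerA mulVf ?expf_neq0 ?lt0r_neq0// scale1r => ->.
  by rewrite scale_scalar_mx /l expr_div_n mulrC.
have QQt : Q *m Q^T = (l ^+ 2)%:M.
  have : (l ^- 2 *: Q^T) *m Q = 1%:M.
    by rewrite -scalemxAl QtQ scale_scalar_mx mulVf// expf_neq0// lt0r_neq0.
  move=> /mulmx1C; rewrite -scalemxAr => /(congr1 (fun A => (l ^+ 2) *: A)).
  by rewrite scalerA mulfV ?expf_neq0 ?lt0r_neq0// scale1r => ->; rewrite scalemx1.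
pose h y := l^-1 *: y + (- l^-1 *: (b2 - b1 *m Q)).
have hf x : dot (h (affine T2 b2 x)) (h (affine T2 b2 x)) =
            dot (affine T1 b1 x) (affine T1 b1 x).
  have -> : h (affine T2 b2 x) = l^-1 *: (affine T1 b1 x *m Q).
    rewrite /h scaleNr -scalerBr; congr (_ *: _).
    by rewrite /affine mulmxDl -mulmxA /Q mulKVmx// opprB addrA addrAC addrK.
  rewrite dotZl dotZr dotMl -mulmxA QQt mul_mx_scalar dotZr.
  by field; exact: lt0r_neq0.
pose B := affine T1 b1 @^-1` ball1.
have mB : measurable (B : set (borel_rV R n)).
  by apply: measurable_affine_preimage; case: bounded_ball1.
have f1B : affine T1 b1 @` B = ball1.
  rewrite image_preimage//; apply/seteqP; split => // y _.
  by exists (affine (invmx T1) (- (b1 *m invmx T1)) y) => //; exact: affineVK.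
have f2B : affine T2 b2 @` B = h @^-1` ball1.
  apply/seteqP; split => [_ [x Bx <-]|y hy]; first by rewrite /ball1 /= hf.
  exists (affine (invmx T2) (- (b2 *m invmx T2)) y); last exact: affineVK.
  by rewrite /B /ball1 /= -hf affineVK.
have Vfin := bounded_borel_fin_num bounded_ball1.
have : volume ball1 = ((l^-1 ^+ n)%:E * volume ball1)%E.
  rewrite {1}(@volume_homothety _ _ l^-1 (- l^-1 *: (b2 - b1 *m Q)))//; last 2 first.
  - by rewrite invr_gt0.
  - by case: bounded_ball1.
  by congr (_ * _)%E; rewrite -[in RHS]f1B (vp1 _ mB) -(vp2 _ mB) f2B.
rewrite -(fineK Vfin) -EFinM => -[/eqP]; rewrite eq_sym -subr_eq0 -{2}[fine _]mul1r -mulrBl.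
rewrite mulf_eq0 [X in _ || X]gt_eqF ?orbF//.
rewrite subr_eq0 pexpr_eq1 ?invr_ge0 ?(ltW l0)// => /eqP/(canRL (@invrK _)).
rewrite invr1 => l1.
by move: l1; rewrite /l => /(canRL (divfK (lt0r_neq0 M10))); rewrite mul1r.
Qed.

End IsotropicPosition.

Section Formula.
Context {R : realType} {n : nat}.
Implicit Types (K : set 'rV[R]_n) (x y u b : 'rV[R]_n) (T : 'M[R]_n) (M L : R).

Lemma det_upper_triangular T : upper_triangular T -> \det T = \prod_i T i i.
Proof.
move=> tT; rewrite -det_tr det_trig; last by apply/is_trig_mxP => i j ij; rewrite mxE tT.
by apply: eq_bigr => i _; rewrite mxE.
Qed.

Lemma triangular_volume_preserving T b : upper_triangular T ->
  (forall i, 0 < T i i) -> \det T = 1 -> volume_preserving (affine T b).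
Proof.
move=> tT T0 dT B mB.
have uT : T \in unitmx by rewrite unitmxE dT unitr1.
rewrite (volume_triangular b tT T0); last exact: measurable_image_affine.
by rewrite -det_upper_triangular// dT mul1e preimage_image_affine.
Qed.

Lemma whitening K : convex_body K -> exists T,
  [/\ upper_triangular T, forall i, 0 < T i i &
      T^T *m inertia K *m T = 1%:M].
Proof.
move=> bK; apply: cholesky; first exact: inertia_sym.
by move=> u; exact: inertia_pos.
Qed.

Lemma isotropic_position K : (0 < n)%N -> convex_body K -> exists T b M,
  [/\ volume_preserving (affine T b), 0 < M, isotropic (affine T b @` K) M &
      M ^+ (2 * n) = \det (inertia K)].
Proof.
move=> n0 bK; have [T [tT T0 ET]] := whitening bK.
have d0 : 0 < \det T by rewrite det_upper_triangular// prodr_gt0.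
pose M := \det T `^ (- (n%:R)^-1).
have M0 : 0 < M by exact: powR_gt0.
have Mn : M ^+ n = (\det T)^-1.
  rewrite -powR_mulrn; last exact: ltW.
  rewrite -powRrM mulNr mulVf ?pnatr_eq0 -?lt0n//.
  by rewrite powRN powRr1// ltW.
pose c := centroid K.
have tMT : upper_triangular (M *: T) by move=> i j ij; rewrite mxE tT// mulr0.
have dMT : \det (M *: T) = 1.
  by rewrite detZ Mn mulVf// lt0r_neq0.
have E : (M *: T)^T *m inertia K *m (M *: T) = (M ^+ 2)%:M.
  by rewrite [(M *: T)^T]linearZ /= -!scalemxAl -scalemxAr ET scalerA scalemx1 expr2.
have vp : volume_preserving (affine (M *: T) (- (c *m (M *: T)))).
  by apply: triangular_volume_preserving => // i; rewrite mxE mulr_gt0.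
exists (M *: T), (- (c *m (M *: T))), M; split => //.
  apply: inertia_isotropic => //; first by rewrite unitmxE dMT unitr1.
  by rewrite /affine subrr.
have := congr1 (fun A : 'M[R]_n => \det A) E.
by rewrite !det_mulmx det_tr dMT mul1r mulr1 det_scalar exprM => ->.
Qed.

(** The isotropic position used to compute the constant is given by a Cholesky
    factor of the inertia matrix, rescaled to determinant 1. *)
Lemma isotropy_constantP K : (0 < n)%N -> convex_body K ->
  0 < isotropy_constant K /\
  isotropy_constant K ^+ (2 * n) * vol K ^+ (n + 2) =
  \det (inertia K).
Proof.
move=> n0 bK; have [T [b [M [vp M0 iso ME]]]] := isotropic_position n0 bK.
have v0 := body_vol_gt0 bK.
pose L := M / fine (volume K) `^ ((n + 2)%:R / (2 * n)%:R).
have -> : isotropy_constant K = L.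
  apply: xget_unique; first by exists (affine T b), M; split => //; exists T, b.
  move=> L' [f [M' [[T' [b' fE]] vp' M'0 iso' ->]]].
  have {}fE : f = affine T' b' by apply/funext.
  rewrite fE in vp' iso'; rewrite /L; congr (_ / _).
  apply: (isotropic_position_unique n0 vp' vp M'0 M0).
  - exact: isotropic_unitmx vp' M'0 iso'.
  - exact: isotropic_unitmx vp M0 iso.
  - exact: isotropic_inertia vp' M'0 iso'.
  - exact: isotropic_inertia vp M0 iso.
rewrite /L -/(vol _); split; first by rewrite divr_gt0// powR_gt0.
have -> : (M / vol K `^ ((n + 2)%:R / (2 * n)%:R)) ^+ (2 * n) =
    M ^+ (2 * n) / vol K ^+ (n + 2).
  rewrite expr_div_n; congr (_ / _).
  rewrite -[LHS]powR_mulrn ?powR_ge0// -powRrM divfK ?powR_mulrn ?ltW//.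
  by rewrite pnatr_eq0 muln_eq0/= -lt0n.
by rewrite divfK// expf_neq0// lt0r_neq0.
Qed.

(** In whitening coordinates this is the squared norm, the quadratic form of the
    inverse of the inertia matrix. *)
Definition sqnorm_coord T p x : R := \sum_i acoord T p i x ^+ 2.

Lemma cont_sqnorm_coord T p : continuous (sqnorm_coord T p).
Proof.
apply: cont_sum => i; under eq_fun do rewrite expr2.
by apply: cont_mul; exact: cont_acoord.
Qed.

Lemma whitened_mean K T i : convex_body K ->
  integ K (acoord T (centroid K) i) = 0.
Proof.
move=> bK; set c := centroid _.
transitivity (integ K (fun x => dot (x - c) (row i T^T))).
  by apply: eq_integ => x _; rewrite acoordE.
rewrite integ_dot ?subrr ?dotE ?mul0mx ?mxE ?mulr0//; first exact: body_bounded.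
exact: body_vol_gt0.
Qed.

Lemma whitened_moment K T i j : convex_body K ->
  T^T *m inertia K *m T = 1%:M ->
  let c := centroid K in
  integ K (fun x => acoord T c i x * acoord T c j x) = (i == j)%:R.
Proof.
move=> bK ET c.
have := inertia_congr T c i j (body_bounded bK) (body_vol_gt0 bK).
by rewrite ET !whitened_mean// mul0r mulr0 subr0 => <-; rewrite mxE.
Qed.

Lemma integ_sqnorm_coord (A : set (borel_rV R n)) T p : bounded_borel A ->
  integ A (sqnorm_coord T p) = \sum_i integ A (fun x => acoord T p i x * acoord T p i x).
Proof.
move=> bA; transitivity (integ A (fun x => \sum_i acoord T p i x * acoord T p i x)).
  by apply: eq_integ => x _; apply: eq_bigr => i _; rewrite expr2.
by rewrite integ_sum// => i; apply: cont_mul; exact: cont_acoord.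
Qed.

Lemma sqnorm_coord_convex T c p x (t : R) : 0 <= t <= 1 ->
  sqnorm_coord T c (p + t *: (x - p)) <= (1 - t) * sqnorm_coord T c p + t * sqnorm_coord T c x.
Proof.
move=> /andP[t0 t1]; rewrite /sqnorm_coord !mulr_sumr -big_split/=; apply: ler_sum => i _.
have -> : acoord T c i (p + t *: (x - p)) =
    acoord T c i p + t * (acoord T c i x - acoord T c i p).
  by rewrite !acoordE -dotBl -dotZl -dotDl; congr dot; apply/rowP => j; rewrite !mxE; ring.
set a := acoord _ _ _ p; set b := acoord _ _ _ x.
have : 0 <= t * (1 - t) * (a - b) ^+ 2.
  by rewrite mulr_ge0 ?sqr_ge0// mulr_ge0//; lra.
by nra.
Qed.

(** D f is the change of the integral of f when K is replaced by K'. Passing to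
    the whitening coordinates of K multiplies the determinants of both inertia
    matrices by (det T)^2, so the comparison can be made in these coordinates. *)
Lemma isotropy_constant_lt K (T : 'M[R]_n) (B : R) : (0 < n)%N -> convex_body K ->
  T^T *m inertia K *m T = 1%:M -> 0 <= B ->
  let c := centroid K in
  exists2 C : R, 0 < C & forall (K' : set 'rV[R]_n) (d : R), convex_body K' ->
   let D f := integ K' f - integ K f in
   0 <= d -> C * d <= 1 -> `|D (fun=> 1)| <= d ->
   (forall i, `|D (acoord T c i)| <= B * d) ->
   (forall i j, `|D (fun x => acoord T c i x * acoord T c j x)| <= B * d) ->
   C * d ^+ 2 < D (fun x => sqnorm_coord T c x - (n + 2)%:R / vol K) ->
   isotropy_constant K < isotropy_constant K'.
Proof.
move=> n0 bK ET B0 c; have bbK := body_bounded bK; have v0 := body_vol_gt0 bK.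
have [C C0 hC] := normalized_det_gain n v0 B0.
exists C => // K' d bK' D d0 Cd D1 Da DG gain.
have bbK' := body_bounded bK'; have v'0 := body_vol_gt0 bK'.
pose s := D (fun=> 1).
pose a : 'rV[R]_n := \row_i D (acoord T c i).
pose G : 'M[R]_n := \matrix_(i, j) D (fun x => acoord T c i x * acoord T c j x).
have cT i : continuous (acoord T c i) by exact: cont_acoord.
have mean0 i : integ K (acoord T c i) = 0.
  exact: whitened_mean.
have moment1 i j : integ K (fun x => acoord T c i x * acoord T c j x) = (i == j)%:R.
  exact: whitened_moment.
have sE : vol K' = vol K + s.
  by rewrite /s /D -!volE// addrCA subrr addr0.
have E' : T^T *m inertia K' *m T =
   1%:M + G - (vol K + s)^-1 *: (a^T *m a).
  apply/matrixP => i j; rewrite (inertia_congr T c)// -sE !mxE big_ord1 !mxE.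
  by rewrite /D !mean0 !subr0 moment1 addrCA subrr addr0.
have trG : \tr G - (n + 2)%:R / vol K * s =
   D (fun x => sqnorm_coord T c x - (n + 2)%:R / vol K).
  have csq : continuous (sqnorm_coord T c) by exact: cont_sqnorm_coord.
  rewrite /D !integB//; try exact: cont_cst.
  rewrite !integ_cst// -/(vol _) {1}sE /s /D -!volE//.
  rewrite !integ_sqnorm_coord// /mxtrace; under eq_bigr do rewrite mxE /D.
  by rewrite sumrB; ring.
have [||||||v's gain'] := hC d s a G => //.
- by move=> i; rewrite mxE.
- by move=> i j; rewrite mxE.
- by rewrite trG.
rewrite -E' -sE in gain'.
have [L0 LE] := isotropy_constantP n0 bK.
have [L'0 LE'] := isotropy_constantP n0 bK'.
have detT K0 : \det (T^T *m inertia K0 *m T) =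
   \det T ^+ 2 * \det (inertia K0).
  by rewrite !det_mulmx det_tr; ring.
have one : \det T ^+ 2 * \det (inertia K) = 1.
  by rewrite -detT ET det1.
rewrite detT -LE' in gain'; rewrite -LE in one.
rewrite -(@ltr_pXn2r _ (2 * n)) ?nnegrE ?ltW// ?muln_gt0//.
set l := isotropy_constant K ^+ _ in one *; set l' := isotropy_constant K' ^+ _ in gain' *.
set w := vol _ ^+ _ in one gain'; set w' := vol _ ^+ _ in gain'.
have w0 : 0 < w by exact: exprn_gt0.
have w'0 : 0 < w' by exact: exprn_gt0.
have dT0 : 0 < \det T ^+ 2.
  rewrite lt_def sqr_ge0 andbT; apply/eqP => E; move: one; rewrite E mul0r => /eqP.
  by rewrite eq_sym oner_eq0.
have : \det T ^+ 2 * (l * w) * w' < \det T ^+ 2 * (l' * w') * w by rewrite one mul1r.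
have -> : \det T ^+ 2 * (l * w) * w' = (\det T ^+ 2 * w * w') * l by ring.
have -> : \det T ^+ 2 * (l' * w') * w = (\det T ^+ 2 * w * w') * l' by ring.
by rewrite ltr_pM2l ?(mulr_gt0 (mulr_gt0 dT0 w0) w'0).
Qed.

End Formula.

(** * Segments and cones in convex sets *)

Section ConvexGeometry.
Context {R : realType} {n : nat}.
Implicit Types (K D : set 'rV[R]_n) (p x y z : 'rV[R]_n).

(** [convex_set] unfolded, with real scalars in place of the interval type. *)
Definition is_convex K := forall x y (t : R), 0 <= t <= 1 -> K x -> K y ->
  K (x + t *: (y - x)).

Lemma convex_setP K : convex_set (K : set (convex_lmodType 'rV[R]_n)) <-> is_convex K.
Proof.
split=> [cK x y t /andP[t0 t1] Kx Ky|cK x y l].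
  have t01 : 0 <= 1 - t <= 1 by lra.
  have := cK x y (Itv01 (andP t01).1 (andP t01).2) (mem_set Kx) (mem_set Ky).
  by rewrite inE; congr K; rewrite /conv /= /unstable.onem; vec.
rewrite !inE => Kx Ky.
have l0 : 0 <= l%:num by [].
have l1 : l%:num <= 1 by [].
have l01 : 0 <= 1 - l%:num <= 1 by lra.
have := cK x y (1 - l%:num) l01 Kx Ky; congr K; rewrite /conv /= /unstable.onem; vec.
Qed.

Lemma interior_ballP K x : interior K x <-> exists2 e : R, 0 < e & forall z, `|z - x| < e -> K z.
Proof.
rewrite /interior; split => [/nbhs_ballP[e e0 h]|[e e0 h]].
  by exists e => // z zx; apply: h; rewrite -ball_normE /= distrC.
by apply/nbhs_ballP; exists e => // z; rewrite -ball_normE /= distrC; exact: h.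
Qed.

Lemma interior_mix K p x (t : R) : is_convex K -> interior K p -> K x -> 0 <= t < 1 ->
  interior K (p + t *: (x - p)).
Proof.
move=> cK /interior_ballP[e e0 h] Kx /andP[t0 t1].
have t1' : 0 < 1 - t by lra.
apply/interior_ballP; exists ((1 - t) * e); first exact: mulr_gt0.
move=> z zz; pose w := p + (1 - t)^-1 *: (z - (p + t *: (x - p))).
have Kw : K w.
  apply: h; rewrite /w addrAC subrr add0r normrZ gtr0_norm ?invr_gt0//.
  by rewrite mulrC ltr_pdivrMr// mulrC.
have := cK w x t; rewrite t0 ltW// => /(_ isT Kw Kx); congr K.
by apply/rowP => i; rewrite !mxE; field; lra.
Qed.

Lemma compact_closure K : compact K -> closure K = K.
Proof. by move=> /compact_closed_rV cK; apply/esym/closure_id. Qed.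

Lemma boundaryP K x : compact K -> boundary K x <-> K x /\ ~ interior K x.
Proof. by move=> cK; rewrite /boundary compact_closure. Qed.

(** If some point of the segment were interior, then by [interior_mix], applied
    towards a or towards b, so would be every point strictly between a and b. *)
Lemma boundary_segment K a b (t : R) : compact K -> is_convex K -> K a -> K b ->
  0 < t < 1 -> ~ interior K (a + t *: (b - a)) -> segment a b `<=` boundary K.
Proof.
move=> cptK cK Ka Kb /andP[t0 t1] nint _ [s /= /andP[s0 s1] <-].
have -> : (1 - s) *: a + s *: b = a + s *: (b - a) by vec.
apply: (boundaryP _ cptK).2; split; first by apply: (cK) => //; rewrite s0 s1.
move=> sint; apply: nint; have [st|st] := leP t s.
  have sn0 : 0 < s by lra.
  have -> : a + t *: (b - a) =
     (a + s *: (b - a)) + (1 - t / s) *: (a - (a + s *: (b - a))).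
    by apply/rowP => i; rewrite !mxE; field; lra.
  apply: interior_mix => //.
  have : t / s <= 1 by rewrite ler_pdivrMr// mul1r.
  by have : 0 < t / s by [exact: divr_gt0]; lra.
have s1' : 0 < 1 - s by lra.
have -> : a + t *: (b - a) =
   (a + s *: (b - a)) + ((t - s) / (1 - s)) *: (b - (a + s *: (b - a))).
  by apply/rowP => i; rewrite !mxE; field; lra.
apply: interior_mix => //; rewrite ltr_pdivrMr// mul1r ltrBlDr subrK t1 andbT.
by apply: divr_ge0; lra.
Qed.

(** Otherwise the whole segment from x0 to x would lie in the boundary. *)
Lemma strict_point_interior K x0 x (t : R) : compact K -> is_convex K ->
  local_strict_convexity_point K x0 -> K x -> x != x0 -> 0 < t < 1 ->
  interior K (x0 + t *: (x - x0)).
Proof.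
move=> cptK cK [bx0 strict] Kx xx0 t01; apply: contrapT => nint; apply: strict.
have Kx0 : K x0 by case/(boundaryP _ cptK): bx0.
exists x0, x; split; first by rewrite eq_sym.
  exact: boundary_segment nint.
by exists 0 => /=; [rewrite lexx ler01|vec].
Qed.

Lemma compact_sub_open (A O : set 'rV[R]_n) : compact A -> open O -> A `<=` O ->
  exists2 r : R, 0 < r & forall a z, A a -> `|z - a| < r -> O z.
Proof.
move=> /compact_near_coveringP cA oO AO.
have := cA _ (0^'+ : set_system R) (fun r x => forall z, `|z - x| < r -> O z) _.
case.
  move=> x /AO Ox; have : nbhs x O by exact: open_nbhs_nbhs.
  move=> /nbhs_ballP[e /= e0 he]; exists (ball x (e / 2), [set r | r < e / 2]).
    split => /=; first by apply: nbhsx_ballx; lra.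
    by apply: nbhs_right_lt; lra.
  move=> [y r] /= [+ re]; rewrite -ball_normE /= => xy z zy; apply: he.
  rewrite -ball_normE /= -(subrKA y) (le_lt_trans (ler_normD _ _))//.
  by rewrite -(distrC z); lra.
move=> e /= e0 he; exists (e / 2); first by lra.
move=> a z Aa za; apply: (he (e / 2)) za => //=.
  by rewrite sub0r normrN gtr0_norm; lra.
by lra.
Qed.

(** For a nonempty convex D this is the convex hull of p and D. *)
Definition cone p D : set 'rV[R]_n :=
  [set z | exists t x, [/\ 0 <= t <= 1, D x & z = p + t *: (x - p)]].

Lemma cone_compact p D : compact D -> compact (cone p D).
Proof.
move=> cD; pose f (u : R * 'rV[R]_n) := p + u.1 *: (u.2 - p).
have -> : cone p D = f @` (`[0, 1] `*` D).
  apply/seteqP; split => [z [t [x [t01 Dx ->]]]|_ [[t x] /= [t01 Dx] <-]].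
    by exists (t, x) => //=; split => //=; rewrite in_itv.
  by exists t, x; split => //; rewrite in_itv/= in t01.
apply: continuous_compact.
  apply: continuous_subspaceT; apply: continuous_rV => j.
  under eq_fun do rewrite /f !mxE.
  have c2 : continuous (fun x : R * 'rV[R]_n => x.2 ord0 j).
    move=> u; apply: (@continuous_comp _ _ _ snd (fun y : 'rV[R]_n => y ord0 j)).
      exact: cvg_snd.
    exact: cont_coord.
  apply: cont_add; first exact: cont_cst.
  apply: cont_mul; first by move=> u; exact: cvg_fst.
  by apply: cont_add => //; exact: cont_cst.
by apply: compact_setX => //; exact: segment_compact.
Qed.

Lemma cone_sub p D : D `<=` cone p D.
Proof. by move=> x Dx; exists 1, x; rewrite ler01 lexx; split => //; vec. Qed.

Lemma cone_apex p D : D !=set0 -> cone p D p.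
Proof. by move=> [x Dx]; exists 0, x; rewrite ler01 lexx; split => //; vec. Qed.

Lemma cone_subset p D K : is_convex K -> K p -> D `<=` K -> cone p D `<=` K.
Proof. by move=> cK Kp DK z [t [x [t01 /DK Kx ->]]]; exact: cK. Qed.

Lemma cone_star p D z (s : R) : 0 <= s <= 1 -> cone p D z -> cone p D (p + s *: (z - p)).
Proof.
move=> /andP[s0 s1] [t [x [/andP[t0 t1] Dx ->]]]; exists (s * t), x; split => //.
  by rewrite mulr_ge0//= mulr_ile1.
by vec.
Qed.

Lemma cone_convex p D : is_convex D -> is_convex (cone p D).
Proof.
move=> cD z1 z2 l /andP[l0 l1] [t1 [x1 [/andP[t10 t11] Dx1 ->]]] [t2 [x2 [/andP[t20 t21] Dx2 ->]]].
pose t := (1 - l) * t1 + l * t2.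
have l1' : 0 <= 1 - l by lra.
have a0 : 0 <= (1 - l) * t1 by exact: mulr_ge0.
have b0 : 0 <= l * t2 by exact: mulr_ge0.
have [t0|t0] := eqVneq t 0.
  have [a1 b1] : (1 - l) * t1 = 0 /\ l * t2 = 0 by move: t0; rewrite /t; lra.
  exists 0, x1; rewrite lexx ler01; split => //; apply/rowP => i; rewrite !mxE.
  transitivity (p ord0 i + ((1 - l) * t1) * (x1 ord0 i - p ord0 i) + (l * t2) * (x2 ord0 i - p ord0 i)).
    by ring.
  by rewrite a1 b1; ring.
have tp : 0 < t by rewrite lt_def t0 addr_ge0.
exists t, (x1 + (l * t2 / t) *: (x2 - x1)); split.
- rewrite ltW//=; have : (1 - l) * t1 <= 1 - l by rewrite ler_piMr.
  by have : l * t2 <= l by [rewrite ler_piMr]; rewrite /t; lra.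
- apply: cD => //; apply/andP; split; first exact: divr_ge0 (ltW tp).
  by rewrite ler_pdivrMr// mul1r /t; lra.
- by apply/rowP => i; rewrite !mxE; move: tp; rewrite /t => tp; field; lra.
Qed.

End ConvexGeometry.

(** * Closeness in the Hausdorff and Banach-Mazur distances *)

Section Closeness.
Context {R : realType} {n : nat}.
Implicit Types (K : set 'rV[R]_n) (p x y z : 'rV[R]_n).

Definition homothety p (r : R) x : 'rV[R]_n := p + r *: (x - p).

(** Each body contains the copy of the other shrunk by 1 + e about p. This one
    condition controls both distances at once. *)
Definition near_homothetic p (e : R) K K' :=
  (forall x, K x -> K' (homothety p (1 + e)^-1 x)) /\
  (forall x, K' x -> K (homothety p (1 + e)^-1 x)).

Lemma enormZ (a : R) x : enorm (a *: x) = `|a| * enorm x.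
Proof.
rewrite /enorm dotZl dotZr mulrA -expr2 sqrtrM ?sqr_ge0// sqrtr_sqr//.
Qed.

Lemma near_hausdorff K p (eps : R) : compact K -> 0 < eps ->
  exists2 e : R, 0 < e & forall e' K', 0 < e' <= e -> near_homothetic p e' K K' ->
    hausdorff_dist K' K < eps.
Proof.
move=> cK eps0; have bK := compact_bounded_borel cK.
have cd := @cont_sqdist R n p.
have [M M0 hM] := continuous_bounded_on bK cd.
pose D := Num.sqrt M; have D0 : 0 <= D by exact: sqrtr_ge0.
have KD x : K x -> enorm (x - p) <= D.
  by move=> /hM Mx; rewrite /enorm /D; apply: ler_wsqrtr; exact: le_trans (ler_norm _) Mx.
exists (eps / (2 * (D + 1))); first by rewrite divr_gt0// mulr_gt0//; lra.
move=> e K' /andP[e0 he] [KK' K'K].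
have eD : e * D < eps.
  apply: (@le_lt_trans _ _ (e * (2 * (D + 1)) / 2)); first by nra.
  have : e * (2 * (D + 1)) <= eps by rewrite -ler_pdivlMr//; lra.
  by lra.
apply: le_lt_trans eD; apply: ge_inf; first by exists 0 => r [].
have e1 : 0 < 1 + e by lra.
split; first by rewrite mulr_ge0// ltW.
- move=> x /K'K Ky; exists (homothety p (1 + e)^-1 x) => //.
  have -> : x - homothety p (1 + e)^-1 x = e *: (homothety p (1 + e)^-1 x - p).
    by apply/rowP => i; rewrite !mxE; field; lra.
  by rewrite enormZ gtr0_norm//; apply: ler_wpM2l; [exact: ltW|exact: KD].
- move=> y Ky; exists (homothety p (1 + e)^-1 y); first exact: KK'.
  have -> : homothety p (1 + e)^-1 y - y = (- (e / (1 + e))) *: (y - p).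
    by apply/rowP => i; rewrite !mxE; field; lra.
  rewrite enormZ normrN gtr0_norm ?divr_gt0//; apply: ler_pM => //.
  + by rewrite divr_ge0 ?ltW.
  + exact: sqrtr_ge0.
  + by rewrite ler_pdivrMr//; nra.
  + exact: KD.
Qed.

Lemma near_banach_mazur K p (eps : R) : 0 < eps ->
  exists2 e : R, 0 < e & forall e' K', 0 < e' <= e -> near_homothetic p e' K K' ->
    banach_mazur_dist K' K < eps.
Proof.
move=> eps0; exists (eps / 3); first by rewrite divr_gt0.
move=> e K' /andP[e0 he] [KK' K'K].
have e1 : 0 < 1 + e by lra.
rewrite /banach_mazur_dist; set S := [set l | _]; pose l := (1 + e) ^+ 2.
have Sl : S l.
  split; first by rewrite /l; nra.
  exists p, p, (1 + e)%:M; split.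
  - by rewrite unitmxE det_scalar unitfE expf_neq0// lt0r_neq0.
  - move=> _ [k Kk <-]; exists (homothety p (1 + e)^-1 k); first exact: KK'.
    by rewrite mul_mx_scalar; apply/rowP => i; rewrite !mxE; field; lra.
  - move=> _ [k Kk <-]; exists (homothety p (1 + e)^-1 k); first exact: K'K.
    by rewrite mul_mx_scalar /l; apply/rowP => i; rewrite !mxE; field; lra.
have S1 : lbound S 1 by move=> r [].
have infl : inf S <= l by apply: ge_inf => //; exists 1.
have inf1 : 1 <= inf S by apply: lb_le_inf => //; exists l.
apply: (@le_lt_trans _ _ (ln l)).
  by rewrite ler_ln// posrE; [lra|rewrite /l exprn_gt0].
rewrite /l lnXn// -mulr_natl; apply: (@le_lt_trans _ _ (2 * e)); last by lra.
by rewrite ler_pM2l//; apply: le_ln1Dx; lra.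
Qed.

Lemma not_local_maximizer K p : compact K ->
  (forall e : R, 0 < e -> exists K', [/\ convex_body K', near_homothetic p e K K' &
     isotropy_constant K < isotropy_constant K']) ->
  ~ local_maximizer hausdorff_dist K /\ ~ local_maximizer banach_mazur_dist K.
Proof.
move=> cK h; split => -[eps eps0 hmax].
  have [e e0 he] := near_hausdorff p cK eps0.
  have [K' [bK' nK']] := h e e0; rewrite ltNge hmax//.
  by apply: (he e) => //; rewrite e0 lexx.
have [e e0 he] := near_banach_mazur K p eps0.
have [K' [bK' nK']] := h e e0; rewrite ltNge hmax//.
by apply: (he e) => //; rewrite e0 lexx.
Qed.

End Closeness.

(** * Thin slabs have small volume *)

Section Slabs.
Context {R : realType} {n : nat}.
Implicit Types (p x y z u w : 'rV[R]_n).

Lemma vol_translate (A : set (borel_rV R n)) b : measurable A ->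
  vol ((fun x => x + b) @^-1` A) = vol A.
Proof.
move=> mA; rewrite /vol [in RHS](@volume_homothety R n 1 b)// expr1n mul1e.
by congr (fine (volume _)); apply/funext => x; rewrite /preimage /= scale1r.
Qed.

Definition slab (r : R) p u (rho : R) : set (borel_rV R n) :=
  cube n r `&` [set x : 'rV[R]_n | `|dot (x - p) u| <= rho].

Lemma slab_bounded r p u rho : 0 <= r -> bounded_borel (slab r p u rho).
Proof.
move=> r0; split; last by exists r => x []; rewrite cubeE.
apply: closed_measurable_rV; apply: closedI; first exact: closed_cube.
apply: closed_sublevel => x.
apply: (@continuous_comp _ _ _ (fun x : 'rV[R]_n => dot (x - p) u) (fun t : R => `|t|)).
  exact: cont_dot_affine.
exact: norm_continuous.
Qed.

Lemma cube_bounded (r : R) : 0 <= r -> bounded_borel (cube n r).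
Proof.
by move=> r0; split; [exact: measurable_cube|exists r => x; rewrite cubeE].
Qed.

(** A slab and its translate by three half-widths are disjoint and fit in a slab
    four times as thick. *)
Lemma slab_double r p u w rho : 0 <= r -> 0 < rho -> dot w u = 1 ->
  2 * vol (slab r p u rho) <= vol (slab (r + 3 * rho * `|w|) p u (4 * rho)).
Proof.
move=> r0 rho0 wu; set S := slab r p u rho.
have bS : bounded_borel S by exact: slab_bounded.
have r'0 : 0 <= r + 3 * rho * `|w| by rewrite addr_ge0// !mulr_ge0// ltW.
pose S' : set (borel_rV R n) := (fun x : 'rV[R]_n => x + (- (3 * rho) *: w)) @^-1` S.
have mS' : measurable S'.
  have := measurable_affine_preimage 1%:M (- (3 * rho) *: w) bS.1.
  by congr measurable; apply/funext => x; rewrite /preimage /= /affine mulmx1.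
have dotS' x : dot (x + - (3 * rho) *: w - p) u = dot (x - p) u - 3 * rho.
  have -> : x + - (3 * rho) *: w - p = (x - p) - (3 * rho) *: w by vec.
  by rewrite [LHS]dotBl dotZl wu mulr1.
have SS : S `<=` slab (r + 3 * rho * `|w|) p u (4 * rho).
  move=> x [cx /= dx]; split; last by rewrite /=; lra.
  move=> i; apply: le_trans (cx i) _; rewrite lerDl !mulr_ge0// ltW//.
have S'S : S' `<=` slab (r + 3 * rho * `|w|) p u (4 * rho).
  move=> x [cx /= dx]; split.
    move=> i; have := cx i; rewrite !mxE => h.
    have -> : x ord0 i = (x ord0 i + - (3 * rho) * w ord0 i) + (3 * rho) * w ord0 i by ring.
    apply: le_trans (ler_normD _ _) _; apply: lerD => //.
    rewrite normrM (gtr0_norm (_ : 0 < 3 * rho)); last by lra.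
    by apply: ler_wpM2l; [lra|exact: coord_le_norm].
  rewrite /=; move: dx; rewrite dotS' !ler_norml => /andP[d1 d2].
  by apply/andP; split; lra.
have bS' : bounded_borel S' by apply: bounded_borel_sub (slab_bounded _ _ _ r'0) mS' S'S.
have disj : S `&` S' = set0.
  apply/seteqP; split => // x [[_ /= d1] [_ /=]]; rewrite dotS' => d2.
  by move: d1 d2; rewrite !ler_norml => /andP[_ d1] /andP[d2 _]; lra.
have vS' : vol S' = vol S by rewrite vol_translate//; exact: bS.1.
have -> : 2 * vol S = vol (S `|` S').
  rewrite [RHS]volE; last first.
    split; first exact: (measurableU _ _ bS.1 mS').
    have [r1 h1] := bS.2; have [r2 h2] := bS'.2.
    by exists (Num.max r1 r2) => x [/h1|/h2] h; rewrite le_max h ?orbT.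
  rewrite integ_setU//; last exact: cont_cst.
  by rewrite -!volE// vS'; ring.
apply: le_vol.
- exact: (measurableU _ _ bS.1 mS').
- exact: slab_bounded.
- by move=> x [/SS|/S'S].
Qed.

(** Iterating the previous lemma, the slab of half-width 4^-k has at most 2^-k
    times the volume of a fixed cube. *)
Lemma slab_small r p u (eps : R) : 0 <= r -> u != 0 -> 0 < eps ->
  exists2 rho, 0 < rho & vol (slab r p u rho) <= eps.
Proof.
move=> r0 u0 eps0; pose w := (dot u u)^-1 *: u.
have wu : dot w u = 1 by rewrite dotZl mulVf// dot_eq0.
(* the widenings 3 rho 4^j |w| for j < k add up to (4^k - 1) rho |w| *)
have iter k rho : 0 < rho ->
   2 ^+ k * vol (slab r p u rho) <=
   vol (slab (r + (4 ^+ k - 1) * rho * `|w|) p u (4 ^+ k * rho)).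
  move=> rho0; elim: k => [|k IH].
    by rewrite !expr0 mul1r subrr !mul0r addr0 mul1r.
  have k1 : 1 <= (4 : R) ^+ k by apply: exprn_ege1; lra.
  rewrite exprS -mulrA; apply: (@le_trans _ _ (2 * vol (slab (r + (4 ^+ k - 1) * rho * `|w|) p u (4 ^+ k * rho)))).
    by rewrite ler_pM2l.
  have -> : r + (4 ^+ k.+1 - 1) * rho * `|w| =
     (r + (4 ^+ k - 1) * rho * `|w|) + 3 * (4 ^+ k * rho) * `|w| by rewrite exprS; ring.
  have -> : 4 ^+ k.+1 * rho = 4 * (4 ^+ k * rho) by rewrite exprS; ring.
  apply: slab_double => //.
    by rewrite addr_ge0// !mulr_ge0// ?(ltW rho0)//; lra.
  by rewrite mulr_gt0//; lra.
pose V := vol (cube n (r + `|w|)).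
have [k kV] : exists k : nat, V / eps < 2 ^+ k.
  exists (Num.truncn (V / eps)).+1; apply: lt_le_trans (truncnS_gt _) _.
  rewrite -natrX ler_nat; apply: ltnW; exact: ltn_expl.
have rho0 : 0 < (4 : R) ^- k by rewrite invr_gt0 exprn_gt0.
exists (4 ^- k) => //.
have rw0 : 0 <= r + `|w| by rewrite addr_ge0.
have : 2 ^+ k * vol (slab r p u (4 ^- k)) <= V.
  apply: le_trans (iter k _ rho0) _; apply: le_vol.
  - apply: (slab_bounded _ _ _ _).1; rewrite addr_ge0// !mulr_ge0// ?(ltW rho0)//.
    by rewrite subr_ge0; apply: exprn_ege1; lra.
  - exact: cube_bounded.
  - move=> x [cx _] i; apply: le_trans (cx i) _; rewrite lerD2l -[leRHS]mul1r.
    apply: ler_wpM2r => //; rewrite mulrBl mul1r.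
    have -> : (4 : R) ^+ k / 4 ^+ k = 1 by rewrite mulfV// lt0r_neq0// exprn_gt0.
    by lra.
move=> h; rewrite -(@ler_pM2l _ (2 ^+ k)) ?exprn_gt0//; apply: le_trans h _.
by rewrite -ler_pdivrMr//; exact: ltW.
Qed.

End Slabs.

(** * First-order effect of adding or removing a small set *)

Section Perturbation.
Context {R : realType} {n : nat} (K : set 'rV[R]_n) (T : 'M[R]_n).
Hypotheses (n0 : (0 < n)%N) (bK : convex_body K).
Hypothesis ET : T^T *m inertia K *m T = 1%:M.
Let c := centroid K.
Let q := sqnorm_coord T c.
Let r2 := (n + 2)%:R / vol K.

Let coord_bound (r : R) : 0 <= r -> exists2 B : R, 0 <= B & forall x, cube n r x ->
  (forall i, `|acoord T c i x| <= B) /\ (forall i j, `|acoord T c i x * acoord T c j x| <= B).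
Proof.
move=> r0; have bc := cube_bounded (R := R) (n := n) r0.
have /choice[M hM] i : exists M, 0 <= M /\ forall x, cube n r x -> `|acoord T c i x| <= M.
  by have [M M0 h] := continuous_bounded_on bc (@cont_acoord R n T c i); exists M.
pose B := \sum_i M i.
have MB i : M i <= B.
  by rewrite /B (bigD1 i)//= lerDl; apply: sumr_ge0 => j _; case: (hM j).
have B0 : 0 <= B by apply: sumr_ge0 => j _; case: (hM j).
have xB x i : cube n r x -> `|acoord T c i x| <= B.
  by move=> cx; apply: le_trans (MB i); exact: (hM i).2.
exists (B + B ^+ 2); first by rewrite addr_ge0// sqr_ge0.
move=> x cx; split => [i|i j]; first by apply: le_trans (xB x i cx) _; rewrite lerDl sqr_ge0.
rewrite normrM expr2; apply: (@le_trans _ _ (B * B)); last by rewrite lerDr.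
by apply: ler_pM => //; exact: xB.
Qed.

(** To first order the logarithm of the isotropy constant grows with the added
    mass weighted by q - r2, and the error is quadratic in the added volume. The
    cube bounds the coordinates on the added part uniformly in K'. *)
Lemma isotropy_constant_add (r : R) : 0 <= r -> K `<=` cube n r ->
  exists2 C : R, 0 < C & forall K' : set 'rV[R]_n, convex_body K' -> K `<=` K' -> K' `<=` cube n r ->
    let A : set (borel_rV R n) := K' `\` K in
    C * vol A <= 1 -> C * vol A ^+ 2 < integ A (fun x => q x - r2) ->
    isotropy_constant K < isotropy_constant K'.
Proof.
move=> r0 Kr; have [B B0 hB] := coord_bound r0.
have [C C0 hC] := isotropy_constant_lt n0 bK ET B0.
exists C => // K' bK' KK' K'r A CA gain.
have bbK := body_bounded bK; have bbK' := body_bounded bK'.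
have bA : bounded_borel A.
  apply: (bounded_borel_sub bbK'); last exact: subDsetl.
  by apply: measurableD; [exact: bbK'.1|exact: bbK.1].
have DE f : continuous f -> integ K' f - integ K f = integ A f.
  by move=> cf; rewrite -integ_setD//; exact: bbK.1.
have Ar x : A x -> cube n r x by move=> [/K'r].
apply: (hC K' (vol A)) => //.
- exact: vol_ge0.
- rewrite DE; last exact: cont_cst.
  by rewrite -volE// ger0_norm// vol_ge0.
- move=> i; rewrite DE; last exact: cont_acoord.
  apply: le_norm_integ => //; first exact: cont_acoord.
  by move=> x /Ar /hB [].
- move=> i j; have cij : continuous (fun x => acoord T c i x * acoord T c j x).
    by apply: cont_mul; exact: cont_acoord.
  by rewrite DE//; apply: le_norm_integ => // x /Ar /hB [].
- rewrite DE//; apply: cont_sub; [exact: cont_sqnorm_coord|exact: cont_cst].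
Qed.

Lemma isotropy_constant_cut :
  exists2 C : R, 0 < C & forall K' : set 'rV[R]_n, convex_body K' -> K' `<=` K ->
    let A : set (borel_rV R n) := K `\` K' in
    C * vol A <= 1 -> C * vol A ^+ 2 < integ A (fun x => r2 - q x) ->
    isotropy_constant K < isotropy_constant K'.
Proof.
have bbK := body_bounded bK; have [r Kr] := bbK.2.
have Kc x : K x -> cube n `|r| x.
  by move=> /Kr xr; rewrite cubeE//= (le_trans xr)// ler_norm.
have [B B0 hB] := coord_bound (normr_ge0 r).
have [C C0 hC] := isotropy_constant_lt n0 bK ET B0.
exists C => // K' bK' K'K A CA gain.
have bbK' := body_bounded bK'.
have bA : bounded_borel A.
  apply: (bounded_borel_sub bbK); last exact: subDsetl.
  by apply: measurableD; [exact: bbK.1|exact: bbK'.1].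
have DE f : continuous f -> integ K' f - integ K f = - integ A f.
  by move=> cf; rewrite integ_setD// ?opprB//; exact: bbK'.1.
have Ar x : A x -> cube n `|r| x by move=> [/Kc].
apply: (hC K' (vol A)) => //.
- exact: vol_ge0.
- rewrite DE; last exact: cont_cst.
  by rewrite -volE// normrN ger0_norm// vol_ge0.
- move=> i; rewrite DE; last exact: cont_acoord.
  rewrite normrN; apply: le_norm_integ => //; first exact: cont_acoord.
  by move=> x /Ar /hB [].
- move=> i j; have cij : continuous (fun x => acoord T c i x * acoord T c j x).
    by apply: cont_mul; exact: cont_acoord.
  by rewrite DE// normrN; apply: le_norm_integ => // x /Ar /hB [].
- have cq : continuous q by exact: cont_sqnorm_coord.
  have E : integ A (fun x => r2 - q x) = - integ A (fun x => q x - r2).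
    by rewrite !integB ?opprB//; exact: cont_cst.
  by rewrite DE -?E//; apply: cont_sub => //; exact: cont_cst.
Qed.

(** The integral of q over K is n, the trace of the identity, while r2 times the
    volume of K is n + 2. *)
Lemma exists_low_interior_point : exists2 p, interior K p & q p < r2.
Proof.
have bbK := body_bounded bK; have v0 := body_vol_gt0 bK.
have [cK /convex_setP convK [p0 p0K]] := bK.
apply: contrapT => nex.
have qint x : interior K x -> r2 <= q x.
  by move=> xK; rewrite leNgt; apply/negP => qx; apply: nex; exists x.
have cq : continuous q by exact: cont_sqnorm_coord.
have qK x : K x -> r2 <= q x.
  move=> Kx; rewrite leNgt; apply/negP => qx.
  have oq : open [set y | q y < r2] by exact: open_sublevel.
  have [t [/andP[t0 t1] ht]] := open_line (p0 - x) oq qx.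
  move: ht => /=; apply/negP; rewrite -leNgt; apply: qint.
  have -> : x + t *: (p0 - x) = p0 + (1 - t) *: (x - p0) by vec.
  by apply: interior_mix => //; apply/andP; split; lra.
have : r2 * vol K <= integ K q.
  by rewrite -integ_cst//; apply: le_integ => //; exact: cont_cst.
rewrite integ_sqnorm_coord//; under eq_bigr do rewrite whitened_moment// eqxx.
rewrite sumr_const card_ord /r2 divfK ?lt0r_neq0// ler_nat.
by rewrite leqNgt addnS ltnS leq_addr.
Qed.

End Perturbation.

(** * Adding a point near a strictly convex boundary point *)

Section AddPoint.
Context {R : realType} {n : nat}.
Implicit Types (K : set 'rV[R]_n) (p x y z : 'rV[R]_n).

(** The points (1 - tau) x0 + tau k, for k in K away from x0, are interior, and
    form a compact set; so they stay in K when x0 moves slightly to y. What the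
    hull of K and y adds to K is then at most a fraction tau of the way from y to
    a point of K. *)
Lemma cone_near_strict_point K x0 (rho : R) : compact K -> is_convex K ->
  local_strict_convexity_point K x0 -> 0 < rho ->
  exists2 eta : R, 0 < eta & forall y, `|y - x0| < eta ->
    forall z, cone y K z -> ~ K z -> `|z - x0| < rho.
Proof.
move=> cptK cK strict rho0.
have [_ [M KM]] := compact_bounded_borel cptK.
pose D := `|M| + `|x0|.
have KD x : K x -> `|x - x0| <= D.
  move=> /KM xM; apply: le_trans (ler_normB _ _) _; rewrite lerD2r.
  exact: le_trans xM (ler_norm _).
have D0 : 0 <= D by rewrite addr_ge0.
pose tau := Num.min (1 / 2) (rho / (2 * (D + 1))).
have tau0 : 0 < tau.
  by rewrite /tau lt_min; apply/andP; split; [lra|rewrite divr_gt0// mulr_gt0//; lra].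
have tau1 : tau <= 1 / 2 by rewrite /tau ge_min lexx.
have tauD : tau * D < rho / 2.
  have : tau <= rho / (2 * (D + 1)) by rewrite /tau ge_min lexx orbT.
  rewrite ler_pdivlMr; last by lra.
  by nra.
pose F := K `&` [set x | rho / 2 <= `|x - x0|].
have cF : compact F.
  by apply: compact_closedI => //; apply: closed_superlevel; exact: cont_normB.
pose m x := x0 + tau *: (x - x0).
have cm : continuous m.
  apply: continuous_rV => j; under eq_fun do rewrite /m !mxE.
  apply: cont_add; first exact: cont_cst.
  apply: cont_mul; first exact: cont_cst.
  by apply: cont_add; [exact: cont_coord|exact: cont_cst].
have [s s0 hs] : exists2 s : R, 0 < s & forall a z, (m @` F) a -> `|z - a| < s -> interior K z.
  apply: compact_sub_open; last 1 first.
  - move=> _ [x [Kx xr] <-]; apply: strict_point_interior => //; last by lra.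
    by apply/eqP => xx0; move: xr; rewrite /= xx0 subrr normr0; lra.
  - by apply: continuous_compact => //; exact: continuous_subspaceT.
  - exact: open_interior.
exists (Num.min s (rho / 2)); first by rewrite lt_min s0/=; lra.
move=> y; rewrite lt_min => /andP[ys yr] z [t [x [/andP[t0 t1] Kx zE]]] nKz.
have zx0 : z - x0 = (1 - t) *: (y - x0) + t *: (x - x0) by rewrite zE; vec.
have ny0 := normr_ge0 (y - x0); have nx0 := normr_ge0 (x - x0).
have hz : `|z - x0| <= (1 - t) * `|y - x0| + t * `|x - x0|.
  rewrite zx0; apply: le_trans (ler_normD _ _) _; rewrite !normrZ.
  by rewrite (ger0_norm t0) ger0_norm; lra.
have [xr|xr] := ltP `|x - x0| (rho / 2); first by nra.
have [tt|tt] := leP tau t; last first.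
  apply: le_lt_trans hz _; have h1 : t * `|x - x0| <= tau * D.
    by apply: ler_pM => //; [exact: ltW|exact: KD].
  have h2 : (1 - t) * `|y - x0| <= `|y - x0| by rewrite ler_piMl//; lra.
  by lra.
exfalso; apply: nKz.
pose w := y + tau *: (x - y).
have Kw : K w.
  apply: interior_subset; apply: (hs (m x)); first by exists x.
  have -> : w - m x = (1 - tau) *: (y - x0) by rewrite /w /m; vec.
  by rewrite normrZ ger0_norm; [nra|lra].
have -> : z = w + ((t - tau) / (1 - tau)) *: (x - w).
  by rewrite zE /w; apply/rowP => i; rewrite !mxE; field; lra.
apply: cK => //; apply/andP; split; first by apply: divr_ge0; lra.
by rewrite ler_pdivrMr; lra.
Qed.

Lemma ball_small x0 (eps : R) : (0 < n)%N -> 0 < eps ->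
  exists2 rho, 0 < rho & forall A : set (borel_rV R n), measurable A ->
    (forall x : 'rV[R]_n, A x -> `|x - x0| < rho) -> vol A <= eps.
Proof.
move=> n0 eps0; pose i := Ordinal n0; pose u : 'rV[R]_n := delta_mx ord0 i.
have dotu x : dot x u = x ord0 i.
  rewrite /dot (bigD1 i)//= big1 => [|j ji]; first by rewrite /u mxE !eqxx mulr1 addr0.
  by rewrite /u mxE (negbTE ji) andbF mulr0.
have u0 : u != 0.
  by apply/eqP => /rowP/(_ i); rewrite !mxE !eqxx => /eqP; rewrite oner_eq0.
have r0 : 0 <= `|x0| + 1 by rewrite addr_ge0.
have [rho rho0 h] := slab_small x0 r0 u0 eps0.
exists (Num.min rho 1); first by rewrite lt_min rho0 ltr01.
move=> A mA Ar; apply: le_trans h; apply: le_vol => //; first exact: slab_bounded.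
move=> x /Ar; rewrite lt_min => /andP[x1 x2]; split.
  rewrite cubeE//= -(subrK x0 x) addrC; apply: le_trans (ler_normD _ _) _.
  by rewrite lerD2l ltW.
rewrite /= dotu; apply: le_trans (coord_le_norm _ _) _; exact: ltW.
Qed.

Lemma cube_convex (r : R) : 0 <= r -> is_convex (cube n r).
Proof.
move=> r0 x y t /andP[t0 t1]; rewrite cubeE//= => xr yr.
have -> : x + t *: (y - x) = (1 - t) *: x + t *: y by vec.
apply: le_trans (ler_normD _ _) _; rewrite !normrZ (ger0_norm t0) ger0_norm; last by lra.
by nra.
Qed.

Lemma homothety_in K p x (e : R) : is_convex K -> K p -> K x -> 0 < e ->
  K (homothety p (1 + e)^-1 x).
Proof.
by move=> cK Kp Kx e0; apply: cK => //; rewrite invr_ge0 invf_le1; lra.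
Qed.

Lemma cone_body K y : convex_body K -> convex_body (cone y K).
Proof.
move=> [cptK /convex_setP cK [z zK]]; split; first exact: cone_compact.
  by apply/convex_setP; exact: cone_convex.
by exists z; apply: interiorS zK; exact: cone_sub.
Qed.

Lemma near_homothetic_cone K p x0 (e s : R) : is_convex K -> K p -> K x0 ->
  0 < s -> s <= e -> near_homothetic p e K (cone (x0 + s *: (x0 - p)) K).
Proof.
move=> cK Kp Kx0 s0 se; set y := x0 + _; have e0 : 0 < e by exact: lt_le_trans se.
split => [x Kx|_ [t [x [t01 Kx ->]]]]; first by apply: cone_sub; exact: homothety_in.
have -> : homothety p (1 + e)^-1 (y + t *: (x - y)) =
    homothety p (1 + e)^-1 y + t *: (homothety p (1 + e)^-1 x - homothety p (1 + e)^-1 y).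
  by rewrite /homothety; vec.
apply: (cK) => //; last exact: homothety_in.
have -> : homothety p (1 + e)^-1 y = p + ((1 + s) / (1 + e)) *: (x0 - p).
  by rewrite /homothety /y; vec.
apply: cK => //; apply/andP; split; first by apply: divr_ge0; lra.
by rewrite ler_pdivrMr; lra.
Qed.

Lemma extension_notin K p x0 (s : R) : is_convex K -> interior K p ->
  ~ interior K x0 -> 0 < s -> ~ K (x0 + s *: (x0 - p)).
Proof.
move=> cK pK nx0 s0; set y := x0 + _ => Ky; apply: nx0.
have -> : x0 = p + (1 + s)^-1 *: (y - p).
  by rewrite /y; apply/rowP => i; rewrite !mxE; field; lra.
by apply: interior_mix => //; rewrite invr_ge0 invf_lt1; lra.
Qed.

Lemma cone_adds_volume K p y : convex_body K -> interior K p -> ~ K y ->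
  0 < vol (cone y K `\` K).
Proof.
move=> bK pK nKy; have [cptK /convex_setP cK _] := bK.
have bK' := cone_body y bK; have [_ /convex_setP cK' _] := bK'.
have oC : open (~` K) by apply: closed_openC; exact: compact_closed_rV.
apply: (@vol_open_gt0 _ _ (interior (cone y K) `\` K)).
- by apply: openI => //; exact: open_interior.
- have [t [/andP[t0 t1] nKt]] := open_line (p - y) oC nKy.
  exists (y + t *: (p - y)); split => //.
  have -> : y + t *: (p - y) = p + (1 - t) *: (y - p) by vec.
  apply: interior_mix => //; last by apply/andP; split; lra.
    by apply: interiorS pK; exact: cone_sub.
  by apply: cone_apex; exists p; exact: interior_subset.
- by move=> x [/interior_subset K'x nKx].
- apply: (bounded_borel_sub (body_bounded bK')); last exact: subDsetl.
  by apply: measurableD; [exact: (body_bounded bK').1|exact: (body_bounded bK).1].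
Qed.

(** Since q x0 > r2, all the mass added near x0 has q - r2 bounded below by a
    positive k, so its first-order contribution wins once its volume is small. *)
Lemma add_point_increases K (T : 'M[R]_n) p x0 (e : R) : (0 < n)%N -> convex_body K ->
  T^T *m inertia K *m T = 1%:M ->
  interior K p -> local_strict_convexity_point K x0 ->
  (n + 2)%:R / vol K < sqnorm_coord T (centroid K) x0 ->
  0 < e -> exists K', [/\ convex_body K', near_homothetic p e K K' &
    isotropy_constant K < isotropy_constant K'].
Proof.
move=> n0 bK ET pK strict qx0 e0.
have [cptK /convex_setP cK K0] := bK; have bbK := body_bounded bK.
have Kp := interior_subset pK.
have [Kx0 nx0] : K x0 /\ ~ interior K x0 by apply/boundaryP => //; case: strict.
set q := sqnorm_coord T _ in qx0; set r2 := _ / _ in qx0.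
have [M KM] := bbK.2.
have KM' x : K x -> `|x| <= `|M| by move=> /KM /le_trans; apply; exact: ler_norm.
pose r := `|M| + `|x0 - p|.
have r0 : 0 <= r by rewrite !addr_ge0.
have Kr : K `<=` cube n r.
  by move=> x /KM' xM; rewrite cubeE//= (le_trans xM)// lerDl.
have [C C0 hC] := isotropy_constant_add n0 bK ET r0 Kr; clear ET.
have cq : continuous q by exact: cont_sqnorm_coord.
pose k := (q x0 - r2) / 2; have k0 : 0 < k by rewrite /k; lra.
have [rho1 rho10 hrho1] : exists2 rho1 : R, 0 < rho1 & forall x, `|x - x0| < rho1 -> r2 + k <= q x.
  have : nbhs x0 [set x | r2 + k < q x].
    by apply: open_nbhs_nbhs; split; [exact: open_superlevel|rewrite /= /k; lra].
  move=> /nbhs_ballP[d /= d0 hd]; exists d => // x xd; apply: ltW; apply: hd.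
  by rewrite -ball_normE /= distrC.
pose eps := Num.min C^-1 (k / (2 * C)).
have eps0 : 0 < eps by rewrite lt_min invr_gt0 C0/= divr_gt0// mulr_gt0.
have [rho2 rho20 hrho2] := ball_small x0 n0 eps0.
have rho0 : 0 < Num.min rho1 rho2 by rewrite lt_min rho10 rho20.
have [eta eta0 heta] := cone_near_strict_point cptK cK strict rho0.
(* s <= e keeps the hull close to K, s <= 1 keeps y in the cube, and the last
   bound puts y within eta of x0 *)
pose s := Num.min (Num.min e 1) (eta / (`|x0 - p| + 1)).
have d0 : 0 < `|x0 - p| + 1 by rewrite ltr_wpDl.
have s0 : 0 < s by rewrite !lt_min e0 ltr01/= divr_gt0.
have se : s <= e by rewrite !ge_min lexx.
have s1 : s <= 1 by rewrite !ge_min lexx orbT.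
have seta : s * `|x0 - p| < eta.
  have : s * (`|x0 - p| + 1) <= eta by rewrite -ler_pdivlMr// !ge_min lexx !orbT.
  by rewrite mulrDr mulr1; lra.
pose y := x0 + s *: (x0 - p).
have yx0 : `|y - x0| < eta by rewrite /y addrAC subrr add0r normrZ gtr0_norm.
have nKy : ~ K y by exact: extension_notin.
have KK' : K `<=` cone y K by exact: cone_sub.
have bK' := cone_body y bK.
exists (cone y K); split => //; first exact: near_homothetic_cone.
have K'r : cone y K `<=` cube n r.
  apply: cone_subset => //; first exact: cube_convex.
  rewrite cubeE//=; apply: le_trans (ler_normD _ _) _; apply: lerD; first exact: KM'.
  by rewrite normrZ gtr0_norm// ler_piMl.
have mA : measurable (cone y K `\` K : set (borel_rV R n)).
  by apply: measurableD; [exact: (body_bounded bK').1|exact: bbK.1].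
have bA : bounded_borel (cone y K `\` K).
  by apply: (bounded_borel_sub (body_bounded bK')) => //; exact: subDsetl.
have Arho x : (cone y K `\` K) x -> `|x - x0| < Num.min rho1 rho2.
  by move=> [K'x nKx]; exact: heta K'x nKx.
have vA : vol (cone y K `\` K) <= eps.
  by apply: hrho2 => // x /Arho; rewrite lt_min => /andP[].
have vA0 : 0 < vol (cone y K `\` K) by exact: cone_adds_volume pK nKy.
apply: hC => //.
  by rewrite mulrC -ler_pdivlMr// mul1r (le_trans vA)// ge_min lexx.
apply: (@lt_le_trans _ _ (k * vol (cone y K `\` K))).
  rewrite expr2 mulrA ltr_pM2r//.
  have : vol (cone y K `\` K) * (2 * C) <= k.
    by rewrite -ler_pdivlMr ?mulr_gt0// (le_trans vA)// ge_min lexx orbT.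
  by lra.
rewrite -integ_cst//; apply: le_integ => //.
- exact: cont_cst.
- by apply: cont_sub => //; exact: cont_cst.
- move=> x /Arho; rewrite lt_min => /andP[/hrho1 hx _].
  by rewrite -/q -/r2; lra.
Qed.

End AddPoint.

(** * Supporting hyperplanes and caps *)

Section Support.
Context {R : realType} {n : nat}.
Implicit Types (K : set 'rV[R]_n) (p x y z u : 'rV[R]_n).

(** Take a point y outside K close to x0 and let x1 be the point of K nearest to
    y: the hyperplane through x1 orthogonal to y - x1 supports K. Moving from x0
    to x1 spares a limiting argument on supporting hyperplanes at x0 itself. *)
Lemma supporting_functional_near K x0 (V : set 'rV[R]_n) : compact K -> is_convex K ->
  boundary K x0 -> open V -> V x0 ->
  exists x1 u, [/\ K x1, V x1, u != 0 & forall x, K x -> dot (x - x1) u <= 0].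
Proof.
move=> cptK cK /(boundaryP _ cptK)[Kx0 nx0] oV Vx0.
have /nbhs_ballP[d /= d0 hd] : nbhs x0 V by exact: open_nbhs_nbhs.
pose N : R := n%:R + 2.
have N0 : 0 < N by rewrite /N ltr_wpDl.
have [y yx0 nKy] : exists2 y, `|y - x0| < d / N & ~ K y.
  apply: contrapT => h; apply: nx0; apply/interior_ballP; exists (d / N).
    exact: divr_gt0.
  by move=> z zx; apply: contrapT => nKz; apply: h; exists z.
have [x1 /set_mem Kx1 hx1] : exists2 c, c \in K & forall t, t \in K ->
    dot (c - y) (c - y) <= dot (t - y) (t - y).
  apply: compact_EVT_min => //; first by exists x0.
  by apply: continuous_subspaceT; exact: cont_sqdist.
exists x1, (y - x1).
have yx1 : y - x1 != 0 by rewrite subr_eq0; apply/eqP => yx; apply: nKy; rewrite yx.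
split => //.
  apply: hd; rewrite -ball_normE /= distrC -(subrKA y).
  apply: le_lt_trans (ler_normD _ _) _.
  have : `|x1 - y| <= n%:R * `|y - x0|.
    apply: norm_le_dot; first by rewrite mulr_ge0.
    apply: le_trans (hx1 x0 (mem_set Kx0)) _.
    apply: le_trans (dot_le_norm _) _; rewrite distrC exprMn.
    apply: ler_wpM2r; first by rewrite sqr_ge0.
    by rewrite -natrX ler_nat; case: (n) => // k; rewrite expnS expn1 leq_pmulr.
  have : `|y - x0| * N < d by rewrite -ltr_pdivlMr.
  by rewrite /N; have := normr_ge0 (y - x0); lra.
move=> x Kx; rewrite leNgt; apply/negP => pos.
set a := dot (x - x1) (y - x1) in pos; set b := dot (x - x1) (x - x1).
have b0 : 0 <= b by exact: dot_ge0.
pose t := Num.min 1 (a / (b + 1)).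
have b1 : 0 < b + 1 by lra.
have t0 : 0 < t by rewrite lt_min ltr01 divr_gt0.
have t1 : t <= 1 by rewrite ge_min lexx.
have tb : t * (b + 1) <= a by rewrite -ler_pdivlMr// ge_min lexx orbT.
have := hx1 (x1 + t *: (x - x1)).
have Kt : K (x1 + t *: (x - x1)) by apply: cK => //; rewrite t1 ltW.
move=> /(_ (mem_set Kt)).
have -> : x1 + t *: (x - x1) - y = t *: (x - x1) - (y - x1) by vec.
rewrite -(opprB y x1); have -> w : dot (- w) (- w) = dot w w.
  by rewrite -scaleN1r dotZl dotZr; ring.
have -> v w : dot (t *: v - w) (t *: v - w) = t * (t * dot v v) - 2 * (t * dot v w) + dot w w.
  by rewrite dotBl !dotBr !dotZl !dotZr (dotC w v); ring.
rewrite -/a -/b.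
by nra.
Qed.

Lemma support_not_interior K x1 u z : u != 0 ->
  (forall x, K x -> dot (x - x1) u <= 0) -> 0 <= dot (z - x1) u -> ~ interior K z.
Proof.
move=> u0 hK zu /interior_ballP[e e0 he].
have u1 : 0 < `|u| + 1 by rewrite ltr_wpDl.
have := hK (z + (e / (`|u| + 1)) *: u) (he _ _).
rewrite addrAC subrr add0r normrZ gtr0_norm ?divr_gt0//.
have -> : e / (`|u| + 1) * `|u| < e.
  by rewrite mulrAC ltr_pdivrMr// ltr_pM2l//; lra.
move=> /(_ isT); have -> : z + (e / (`|u| + 1)) *: u - x1 = z - x1 + (e / (`|u| + 1)) *: u by vec.
rewrite dotDl dotZl; have : 0 < e / (`|u| + 1) * dot u u.
  by rewrite mulr_gt0 ?divr_gt0// dot_gt0.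
by lra.
Qed.

(** If a supporting hyperplane touches K at x1 only, compactness makes the caps
    it cuts off shrink to x1. *)
Lemma small_caps K x1 u (rho : R) : compact K ->
  (forall x, K x -> x != x1 -> dot (x - x1) u < 0) -> 0 < rho ->
  exists2 eta : R, 0 < eta & forall x, K x -> - eta <= dot (x - x1) u -> `|x - x1| < rho.
Proof.
move=> cptK hK rho0; pose F := K `&` [set x | rho <= `|x - x1|].
have cF : compact F.
  by apply: compact_closedI => //; apply: closed_superlevel; exact: cont_normB.
have [F0|F0] := pselect (F !=set0); last first.
  exists 1 => // x Kx _; rewrite ltNge; apply/negP => xr; apply: F0.
  by exists x.
have [m /set_mem[Km mr] hm] := compact_EVT_max F0 cF
   (continuous_subspaceT (@cont_dot_affine R n x1 u)).
have m0 : dot (m - x1) u < 0.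
  apply: hK => //; apply/eqP => mx; move: mr; rewrite /= mx subrr normr0; lra.
exists (- dot (m - x1) u / 2); first by lra.
move=> x Kx xu; rewrite ltNge; apply/negP => xr.
have /hm : x \in F by rewrite inE; split.
by lra.
Qed.

(** The farthest point of K on the ray from p through z. *)
Lemma ray_boundary K p z : compact K -> K z -> z != p ->
  exists s : R, [/\ 1 <= s, K (p + s *: (z - p)) & ~ interior K (p + s *: (z - p))].
Proof.
move=> cptK Kz zp; have [_ [M KM]] := compact_bounded_borel cptK.
have zp0 : 0 < `|z - p| by rewrite normr_gt0 subr_eq0.
pose L := (`|M| + `|p|) / `|z - p|.
have KL s : 1 <= s -> K (p + s *: (z - p)) -> s <= L.
  move=> s1 /KM h; rewrite /L ler_pdivlMr//.
  have -> : s * `|z - p| = `|(p + s *: (z - p)) - p|.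
    by rewrite addrAC subrr add0r normrZ ger0_norm//; lra.
  apply: le_trans (ler_normB _ _) _; rewrite lerD2r.
  exact: le_trans h (ler_norm _).
pose f (s : R) : 'rV[R]_n := p + s *: (z - p).
have cf : continuous f by exact: cont_line.
pose A := `[1, L]%classic `&` (f @^-1` K).
have A1 : A 1.
  have f1 : f 1 = z by rewrite /f; vec.
  by split; rewrite /= ?f1// in_itv/= lexx KL// -/(f 1) f1.
have cA : compact A.
  apply: compact_closedI; first exact: segment_compact.
  by apply: preimage_closed => [s _|]; [exact: cf|exact: compact_closed_rV].
have [s /set_mem[s1L Ks] hs] := compact_EVT_max (ex_intro _ 1 A1) cA
   (continuous_subspaceT (fun t : R => (fun A => id) : {for t, continuous (@id R)})).
move: s1L; rewrite /= in_itv/= => /andP[s1 sL].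
exists s; split => // /interior_ballP[e e0 he].
pose t := e / (2 * `|z - p|).
have t0 : 0 < t by rewrite divr_gt0// mulr_gt0.
have Kst : K (f (s + t)).
  apply: he; rewrite /f; have -> : p + (s + t) *: (z - p) - (p + s *: (z - p)) = t *: (z - p) by vec.
  rewrite normrZ gtr0_norm// /t; have -> : e / (2 * `|z - p|) * `|z - p| = e / 2.
    by field; exact: lt0r_neq0.
  by lra.
have st1 : 1 <= s + t by lra.
have /hs : s + t \in A by rewrite inE; split => //; rewrite /= in_itv/= st1 KL.
by lra.
Qed.

End Support.

(** * Cutting off a cap *)

Section CutCap.
Context {R : realType} {n : nat}.
Implicit Types (K D : set 'rV[R]_n) (p x y z u : 'rV[R]_n).

Lemma exists_orthogonal x : (1 < n)%N -> exists2 l : 'rV[R]_n, l != 0 & dot x l = 0.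
Proof.
move=> n1; have : kermx x^T != 0.
  rewrite kermx_eq0 /row_free neq_ltn; apply/orP; left.
  by apply: leq_ltn_trans n1; exact: rank_leq_col.
move=> /rowV0Pn[l /sub_kermxP lx l0]; exists l => //.
by rewrite dotC dotE lx mxE.
Qed.

Lemma dot_bound u : exists2 L : R, 0 <= L & forall x, `|dot x u| <= L * `|x|.
Proof.
exists (\sum_i `|u ord0 i|); first exact: sumr_ge0.
move=> x; apply: le_trans (ler_norm_sum _ _ _) _; rewrite mulr_suml.
by apply: ler_sum => i _; rewrite normrM mulrC ler_wpM2l// coord_le_norm.
Qed.

(** Such a cone lies in a thin slab containing the line through p and x1; the slab
    exists because in dimension at least 2 some direction is orthogonal to that
    line. *)
Lemma thin_cone_small p x1 (r eps : R) : (1 < n)%N -> 0 <= r -> 0 < eps ->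
  exists2 rho : R, 0 < rho & forall D : set 'rV[R]_n, compact D ->
    (forall x, D x -> `|x - x1| < rho) -> cone p D `<=` cube n r ->
    vol (cone p D) <= eps.
Proof.
move=> n1 r0 eps0; have [l l0 lx] := exists_orthogonal (x1 - p) n1.
have [L L0 hL] := dot_bound l.
have [rho rho0 h] := slab_small p r0 l0 eps0.
have L1 : 0 < L + 1 by lra.
exists (rho / (L + 1)); first exact: divr_gt0.
move=> D cD Dr Qr; apply: le_trans h; apply: le_vol.
- by apply: compact_measurable_rV; exact: cone_compact.
- exact: slab_bounded.
move=> z Qz; split; first exact: Qr.
case: Qz => t [x [/andP[t0 t1] Dx ->]] /=.
have -> : p + t *: (x - p) - p = t *: ((x - x1) + (x1 - p)) by vec.
rewrite dotZl dotDl lx addr0 normrM (ger0_norm t0).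
have h1 := hL (x - x1); have h2 := Dr x Dx; rewrite ltr_pdivlMr// in h2.
have h3 : t * `|dot (x - x1) l| <= `|dot (x - x1) l| by rewrite ler_piMl.
by have := normr_ge0 (x - x1); nra.
Qed.

Lemma vol_homothety_preimage p (a : R) (Q : set (borel_rV R n)) : 0 < a -> bounded_borel Q ->
  vol ((fun x => p + a^-1 *: (x - p)) @^-1` Q : set (borel_rV R n)) = a ^+ n * vol Q.
Proof.
move=> a0 [mQ bQ]; have a1 : 0 < a^-1 by rewrite invr_gt0.
rewrite {2}/vol (volume_homothety (p - a^-1 *: p) a1 mQ).
rewrite (_ : (fun x : 'rV_n => a^-1 *: x + (p - a^-1 *: p)) = (fun x => p + a^-1 *: (x - p))); last first.
  by apply/funext => x; vec.
have bP : bounded_borel ((fun x => p + a^-1 *: (x - p)) @^-1` Q : set (borel_rV R n)).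
  split.
    have := measurable_affine_preimage (a^-1)%:M (p - a^-1 *: p) mQ.
    congr measurable; apply/funext => x; rewrite /preimage /= /affine mul_mx_scalar; congr Q; vec.
  have [r hr] := bQ; exists (`|p| + a * (r + `|p|)) => x /= /hr xr.
  have -> : x = p + a *: ((p + a^-1 *: (x - p)) - p).
    by apply/rowP => i; rewrite !mxE; field; exact: lt0r_neq0.
  apply: le_trans (ler_normD _ _) _; rewrite lerD2l normrZ gtr0_norm// ler_pM2l//.
  by apply: le_trans (ler_normB _ _) _; rewrite lerD2r.
rewrite fineM//; last exact: bounded_borel_fin_num.
by rewrite /vol /= exprVn mulVKf// lt0r_neq0// exprn_gt0.
Qed.

(** With g the gauge of K about p, the hypothesis on f says f >= k (1 - g). The part
    of D with 1 - g < l lies in Q minus its copy shrunk by 1 - l, so it has volume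
    at most n l vol Q. Choosing l proportional to vol D / vol Q, half of D has
    f >= l k, which makes the integral of order k (vol D)^2 / vol Q: this beats
    any multiple of (vol D)^2 once Q is thin. *)
Lemma integ_gauge_lower (K D Q : set (borel_rV R n)) p (f : 'rV[R]_n -> R) (k : R) :
  bounded_borel D -> bounded_borel Q -> measurable K -> D `<=` Q -> Q `<=` K ->
  (forall z (s : R), 0 <= s <= 1 -> Q z -> Q (p + s *: (z - p))) ->
  continuous f -> (forall z, D z -> 0 <= f z) -> 0 < vol D ->
  0 < k ->
  (forall z (l : R), D z -> 0 < l < 1 -> K (p + (1 - l)^-1 *: (z - p)) -> l * k <= f z) ->
  k * vol D ^+ 2 <= 4 * (n%:R + 1) * vol Q * integ D f.
Proof.
move=> bD bQ mK DQ QK star cf f0 D0 k0 hf.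
have vDQ : vol D <= vol Q by apply: le_vol => //; exact: bD.1.
have Q0 : 0 < vol Q by exact: lt_le_trans vDQ.
pose N : R := n%:R + 1; have N1 : 1 <= N by rewrite /N lerDr.
have NQ : 0 < 2 * N * vol Q by rewrite !mulr_gt0//; lra.
(* then n l vol Q is at most half of vol D *)
pose l := vol D / (2 * N * vol Q).
have l0 : 0 < l by rewrite divr_gt0.
have l1 : l <= 1 / 2 by rewrite /l ler_pdivrMr//; nra.
have l10 : 0 < 1 - l by lra.
pose h x := p + (1 - l)^-1 *: (x - p).
have mh (B : set (borel_rV R n)) : measurable B -> measurable (h @^-1` B : set (borel_rV R n)).
  move=> mB; have := measurable_affine_preimage ((1 - l)^-1)%:M (p - (1 - l)^-1 *: p) mB.
  congr measurable; apply/funext => x; rewrite /preimage /= /affine mul_mx_scalar; congr B; rewrite /h; vec.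
pose D1 : set (borel_rV R n) := D `&` h @^-1` K.
have mD1 : measurable D1 by apply: measurableI; [exact: bD.1|exact: mh].
have bD1 : bounded_borel D1 by apply: (bounded_borel_sub bD) => // x [].
have D1D : D1 `<=` D by move=> x [].
pose Q1 : set (borel_rV R n) := h @^-1` Q.
have Q1Q : Q1 `<=` Q.
  move=> x Qhx; have -> : x = p + (1 - l) *: (h x - p).
    by rewrite /h; apply/rowP => i; rewrite !mxE; field; lra.
  by apply: star => //; apply/andP; split; lra.
have mQ1 : measurable Q1 by apply: mh; exact: bQ.1.
have vQ1 : vol Q1 = (1 - l) ^+ n * vol Q by exact: vol_homothety_preimage.
have bern : 1 - n%:R * l <= (1 - l) ^+ n.
  elim: n => [|m IH]; first by rewrite mul0r subr0 expr0.
  have m0 : 0 <= m%:R :> R by [].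
  apply: (@le_trans _ _ ((1 - l) * (1 - m%:R * l))).
    by rewrite -natr1; nra.
  by rewrite exprS ler_pM2l.
have DD1 : vol D - vol D1 <= n%:R * l * vol Q.
  have -> : vol D - vol D1 = vol (D `\` D1).
    rewrite !volE// ?integ_setD//; first exact: cont_cst.
    by apply: (bounded_borel_sub bD); [apply: measurableD => //; exact: bD.1|exact: subDsetl].
  apply: (@le_trans _ _ (vol (Q `\` Q1))).
    apply: le_vol.
    - by apply: measurableD => //; exact: bD.1.
    - by apply: (bounded_borel_sub bQ); [apply: measurableD => //; exact: bQ.1|exact: subDsetl].
    - move=> x [Dx nD1x]; split; first exact: DQ.
      by move=> Q1x; apply: nD1x; split => //; exact: QK.
  rewrite volE; last first.
    by apply: (bounded_borel_sub bQ); [apply: measurableD => //; exact: bQ.1|exact: subDsetl].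
  rewrite integ_setD//; last exact: cont_cst.
  rewrite -!volE//; last exact: (bounded_borel_sub bQ).
  rewrite vQ1; nra.
have lQ : 2 * N * l * vol Q = vol D.
  by rewrite /l; field; rewrite !lt0r_neq0//; lra.
have vD1 : vol D / 2 <= vol D1.
  have : n%:R * l * vol Q <= N * l * vol Q.
    by apply: ler_wpM2r; [exact: ltW|apply: ler_wpM2r; [exact: ltW|rewrite /N lerDl]].
  by nra.
have step : l * k * vol D1 <= integ D f.
  apply: (@le_trans _ _ (integ D1 f)).
    rewrite -integ_cst//; apply: le_integ => //; first exact: cont_cst.
    by move=> x [Dx Khx]; apply: hf => //; apply/andP; split; lra.
  rewrite -subr_ge0 -integ_setD//; apply: integ_ge0 => x [Dx _]; exact: f0.
rewrite -/N; apply: (@le_trans _ _ (4 * N * vol Q * (l * k * vol D1))); last first.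
  by apply: ler_wpM2l => //; rewrite !mulr_ge0// ?ltW//; lra.
have -> : 4 * N * vol Q * (l * k * vol D1) = 2 * (2 * N * l * vol Q) * k * vol D1 by ring.
rewrite lQ; have : vol D * k * (vol D / 2) <= vol D * k * vol D1.
  by apply: ler_wpM2l => //; rewrite mulr_ge0 ?ltW.
by rewrite expr2; lra.
Qed.

End CutCap.

Section CutCapIncreases.
Context {R : realType} {n : nat}.
Implicit Types (K : set 'rV[R]_n) (p x y z u : 'rV[R]_n).

Definition remove_cap K x1 u (eta : R) : set 'rV[R]_n :=
  K `&` [set x | dot (x - x1) u <= - eta].

Lemma capP K x1 u eta x :
  (K `\` remove_cap K x1 u eta) x <-> K x /\ - eta < dot (x - x1) u.
Proof.
split => [[Kx ncx]|[Kx xu]]; split => //.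
  by rewrite ltNge; apply/negP => xu; apply: ncx.
by move=> [_ /=]; rewrite leNgt xu.
Qed.

Lemma remove_cap_body K x1 u eta p : convex_body K -> interior K p ->
  dot (p - x1) u < - eta -> convex_body (remove_cap K x1 u eta).
Proof.
move=> [cptK /convex_setP cK _] pK pu; have cdot := @cont_dot_affine R n x1 u.
split.
- by apply: compact_closedI => //; exact: closed_sublevel.
- apply/convex_setP => x y t /andP[t0 t1] [Kx /= xu] [Ky /= yu].
  split; first by apply: cK => //; rewrite t0 t1.
  rewrite /=; have -> : x + t *: (y - x) - x1 = (1 - t) *: (x - x1) + t *: (y - x1) by vec.
  by rewrite dotDl !dotZl; nra.
- exists p; rewrite /interior; apply: filterI; first exact: pK.
  have : nbhs p [set x | dot (x - x1) u < - eta].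
    by apply: open_nbhs_nbhs; split => //; exact: open_sublevel.
  by apply: filterS => x /ltW.
Qed.

Lemma near_homothetic_remove_cap K p x1 u (e eta : R) : is_convex K -> K p -> 0 < e ->
  (forall x, K x -> dot (x - x1) u <= 0) ->
  eta <= e * (- dot (p - x1) u) / (1 + e) ->
  near_homothetic p e K (remove_cap K x1 u eta).
Proof.
move=> cK Kp e0 hu he; split => [x Kx|x [Kx _]]; last exact: homothety_in.
split; first exact: homothety_in.
have e1 : 0 < 1 + e by lra.
rewrite /=; have -> : homothety p (1 + e)^-1 x - x1 =
    (e / (1 + e)) *: (p - x1) + (1 + e)^-1 *: (x - x1).
  by rewrite /homothety; apply/rowP => i; rewrite !mxE; field; lra.
rewrite dotDl !dotZl; have : (1 + e)^-1 * dot (x - x1) u <= 0.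
  by rewrite pmulr_rle0 ?invr_gt0//; exact: hu.
by move: he; rewrite mulrAC mulrN; lra.
Qed.

Lemma cap_vol_gt0 K p x1 u (eta : R) : convex_body K -> interior K p -> K x1 ->
  0 < eta -> dot (p - x1) u < - eta -> 0 < vol (K `\` remove_cap K x1 u eta).
Proof.
move=> bK pK Kx1 eta0 pu; have [_ /convex_setP cK _] := bK.
apply: (@vol_open_gt0 _ _ (interior K `&` [set x | - eta < dot (x - x1) u])).
- apply: openI; first exact: open_interior.
  by apply: open_superlevel; exact: cont_dot_affine.
- have oc : open [set x : 'rV[R]_n | - eta < dot (x - x1) u].
    by apply: open_superlevel; exact: cont_dot_affine.
  have x1c : [set x : 'rV[R]_n | - eta < dot (x - x1) u] x1.
    by rewrite /= subrr dotE mul0mx mxE oppr_lt0.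
  have [t [/andP[t0 t1] ht]] := open_line (p - x1) oc x1c.
  exists (x1 + t *: (p - x1)); split => //.
  have -> : x1 + t *: (p - x1) = p + (1 - t) *: (x1 - p) by vec.
  by apply: interior_mix => //; apply/andP; split; lra.
- by move=> x [/interior_subset Kx xu]; apply/capP.
- apply: (bounded_borel_sub (body_bounded bK)); last exact: subDsetl.
  apply: measurableD; first exact: (body_bounded bK).1.
  exact: (body_bounded (remove_cap_body bK pK pu)).1.
Qed.

(** From p, below the cap, the ray through a point z of the cap leaves K at a
    boundary point still in the cap; convexity of q carries the bound back to z. *)
Lemma cap_sqnorm_le K (T : 'M[R]_n) c p x1 u (eta m : R) : compact K ->
  dot (p - x1) u < - eta -> sqnorm_coord T c p <= m ->
  (forall b, K b -> ~ interior K b -> - eta < dot (b - x1) u -> sqnorm_coord T c b <= m) ->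
  forall z, K z -> - eta < dot (z - x1) u -> sqnorm_coord T c z <= m.
Proof.
move=> cptK pu qp hb z Kz zu.
have zp : z != p by apply/eqP => zp; move: zu; rewrite zp; lra.
have [s [s1 Kb nb]] := ray_boundary cptK Kz zp.
set b := p + s *: (z - p) in Kb nb.
have bu : - eta < dot (b - x1) u.
  have -> : b - x1 = (z - x1) + (s - 1) *: ((z - x1) - (p - x1)) by rewrite /b; vec.
  by rewrite dotDl dotZl (dotBl (z - x1)) ltr_wpDr// mulr_ge0//; lra.
have qb := hb b Kb nb bu.
have -> : z = p + s^-1 *: (b - p).
  by rewrite /b; apply/rowP => i; rewrite !mxE; field; lra.
have is0 : 0 <= s^-1 by rewrite invr_ge0; lra.
have is1 : s^-1 <= 1 by rewrite invf_le1; lra.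
apply: le_trans (sqnorm_coord_convex _ _ _ _ _) _; first by rewrite is0.
by nra.
Qed.

(** Only the boundary points near x0 are known to satisfy q <= r2, possibly with
    equality, so the first-order gain of a cap is not bounded below. But q < r2 at
    p, and convexity of q makes r2 - q on the cap at least proportional to 1 minus
    the gauge of K about p. *)
Lemma cut_cap_increases K (T : 'M[R]_n) p x0 (V : set 'rV[R]_n) (e : R) :
  (1 < n)%N -> convex_body K -> T^T *m inertia K *m T = 1%:M ->
  let q := sqnorm_coord T (centroid K) in let r2 := (n + 2)%:R / vol K in
  interior K p -> q p < r2 -> boundary K x0 -> open V -> V x0 ->
  (forall x, V x -> boundary K x -> local_strict_convexity_point K x /\ q x <= r2) ->
  0 < e -> exists K', [/\ convex_body K', near_homothetic p e K K' &
    isotropy_constant K < isotropy_constant K'].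
Proof.
move=> n1 bK ET q r2 pK qp bx0 oV Vx0 hV e0; have n0 := ltnW n1.
have [cptK /convex_setP cK K0] := bK; have bbK := body_bounded bK.
have Kp := interior_subset pK.
have [C C0 hC] := isotropy_constant_cut n0 bK ET; clear ET.
have [x1 [u [Kx1 Vx1 u0 hu]]] := supporting_functional_near cptK cK bx0 oV Vx0.
have bx1 : boundary K x1.
  apply/boundaryP => //; split => //; apply: (support_not_interior u0 hu).
  by rewrite subrr dotE mul0mx mxE.
have [strict _] := hV x1 Vx1 bx1.
(* a second contact point would put a segment through x1 in the boundary *)
have hu' x : K x -> x != x1 -> dot (x - x1) u < 0.
  move=> Kx xx1; rewrite lt_neqAle hu// andbT; apply/eqP => xu.
  have half : 0 < (2^-1 : R) < 1 by apply/andP; split; lra.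
  have := strict_point_interior cptK cK strict Kx xx1 half.
  by apply: (support_not_interior u0 hu); rewrite addrAC subrr add0r dotZl xu mulr0.
pose a := - dot (p - x1) u.
have a0 : 0 < a.
  rewrite /a ltNge; apply/negP => h; apply: (support_not_interior u0 hu _ pK).
  by lra.
have cq : continuous q by exact: cont_sqnorm_coord.
pose k := r2 - q p; have k0 : 0 < k by rewrite /k subr_gt0.
have [r r0 Kr] : exists2 r : R, 0 <= r & K `<=` cube n r.
  have [M KM] := bbK.2; exists `|M| => // x /KM xM; rewrite cubeE//=.
  exact: le_trans xM (ler_norm _).
pose N : R := n%:R + 1; have N1 : 1 <= N by rewrite /N lerDr.
pose eps := Num.min C^-1 (k / (8 * N * C)).
have NC : 0 < 8 * N * C by rewrite !mulr_gt0//; lra.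
have eps0 : 0 < eps by rewrite lt_min invr_gt0 C0 divr_gt0.
have [rho rho0 hrho] := thin_cone_small p x1 n1 r0 eps0.
have /nbhs_ballP[d /= d0 hd] : nbhs x1 V by exact: open_nbhs_nbhs.
have [eta0 eta00 heta0] : exists2 eta : R, 0 < eta &
    forall x, K x -> - eta <= dot (x - x1) u -> `|x - x1| < Num.min rho d.
  by apply: small_caps => //; rewrite lt_min rho0 d0.
pose eta := Num.min eta0 (Num.min (e * a / (1 + e)) (a / 2)).
have e1 : 0 < 1 + e by lra.
have eta_gt0 : 0 < eta by rewrite !lt_min eta00 !divr_gt0// mulr_gt0.
have eta1 : eta <= eta0 by rewrite ge_min lexx.
have eta2 : eta <= e * a / (1 + e) by rewrite !ge_min lexx orbT.
have eta3 : eta <= a / 2 by rewrite !ge_min lexx !orbT.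
have pu : dot (p - x1) u < - eta by move: a0 eta3; rewrite /a; lra.
have near_x1 x : K x -> - eta <= dot (x - x1) u -> `|x - x1| < rho /\ V x.
  move=> Kx xu; have := heta0 x Kx; rewrite lt_min => /(_ _)/andP[|xrho xd]; first by lra.
  by split => //; apply: hd; rewrite -ball_normE /= distrC.
have bK' := remove_cap_body bK pK pu.
pose D : set (borel_rV R n) := K `\` remove_cap K x1 u eta.
have D0 : 0 < vol D by exact: cap_vol_gt0 pu.
have bD : bounded_borel D.
  apply: (bounded_borel_sub bbK); last exact: subDsetl.
  by apply: measurableD; [exact: bbK.1|exact: (body_bounded bK').1].
pose Dc : set 'rV[R]_n := K `&` [set x | - eta <= dot (x - x1) u].
have cptDc : compact Dc.
  by apply: compact_closedI => //; apply: closed_superlevel; exact: cont_dot_affine.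
pose Q := cone p Dc.
have QK : Q `<=` K by apply: cone_subset => // x [].
have bQ : bounded_borel Q by apply: compact_bounded_borel; exact: cone_compact.
have vQ : vol Q <= eps.
  apply: hrho => //; last by move=> x /QK /Kr.
  by move=> x [Kx xu]; have [] := near_x1 x Kx xu.
have DQ : D `<=` Q.
  by move=> x /capP[Kx xu]; apply: cone_sub; split => //=; exact: ltW.
have capq z : D z -> q z <= r2.
  move=> /capP[]; apply: (cap_sqnorm_le cptK pu (ltW qp)) => b Kb nb bu.
  have [_ Vb] := near_x1 b Kb (ltW bu).
  by have [] := hV b Vb ((boundaryP b cptK).2 (conj Kb nb)).
have gauge : k * vol D ^+ 2 <= 4 * N * vol Q * integ D (fun x => r2 - q x).
  apply: (integ_gauge_lower bD bQ bbK.1 DQ QK) => //.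
  - by move=> z s s01; exact: cone_star.
  - by apply: cont_sub => //; exact: cont_cst.
  - by move=> z /capq; rewrite subr_ge0.
  - move=> z l /capP[_ zu] /andP[l0 l1] Kw; set w := p + _ in Kw.
    have l10 : 0 < 1 - l by lra.
    have il : 1 <= (1 - l)^-1 by rewrite invf_ge1//; lra.
    have Dw : D w.
      apply/capP; split => //.
      have -> : w - x1 = (z - x1) + ((1 - l)^-1 - 1) *: ((z - x1) - (p - x1)) by rewrite /w; vec.
      by rewrite dotDl dotZl (dotBl (z - x1)) ltr_wpDr// mulr_ge0//; lra.
    have qw := capq w Dw.
    have zE : z = p + (1 - l) *: (w - p).
      by rewrite /w; apply/rowP => i; rewrite !mxE; field; lra.
    have l01 : 0 <= 1 - l <= 1 by apply/andP; split; lra.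
    have := sqnorm_coord_convex T (centroid K) p w l01.
    by rewrite -zE -/q /k => qz; nra.
exists (remove_cap K x1 u eta); split => //; first exact: near_homothetic_remove_cap.
have vDQ : vol D <= vol Q by apply: le_vol => //; exact: bD.1.
apply: hC => //.
- by move=> x [].
- rewrite -/D mulrC -ler_pdivlMr// mul1r; apply: le_trans vDQ _; apply: le_trans vQ _.
  by rewrite ge_min lexx.
- rewrite -/D -/q -/r2 ltNge; apply/negP => hle.
  have hQ : vol Q * (8 * N * C) <= k.
    by rewrite -ler_pdivlMr// (le_trans vQ)// ge_min lexx orbT.
  have D2 : 0 < vol D ^+ 2 by exact: exprn_gt0.
  have : 4 * N * vol Q * integ D (fun x => r2 - q x) <= 4 * N * vol Q * (C * vol D ^+ 2).
    by apply: ler_wpM2l => //; rewrite !mulr_ge0// ?vol_ge0//; lra.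
  have -> : 4 * N * vol Q * (C * vol D ^+ 2) = (vol Q * (8 * N * C)) * vol D ^+ 2 / 2.
    by field.
  have : (vol Q * (8 * N * C)) * vol D ^+ 2 <= k * vol D ^+ 2 by rewrite ler_pM2r.
  have : 0 < k * vol D ^+ 2 by exact: mulr_gt0.
  by lra.
Qed.

End CutCapIncreases.

Theorem corollary6 (R : realType) (n : nat) (hn : (2 <= n)%N)
    (K : set 'rV[R]_n) (hK : convex_body K)
    (hU : exists U : set 'rV[R]_n,
      [/\ U !=set0,
          exists2 V : set 'rV[R]_n, open V & U = V `&` boundary K &
          forall x, U x -> local_strict_convexity_point K x]) :
  ~ local_maximizer hausdorff_dist K /\ ~ local_maximizer banach_mazur_dist K.
Proof.
have n0 : (0 < n)%N := ltnW hn.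
have [T [_ _ ET]] := whitening hK.
have [p pK qp] := exists_low_interior_point hK ET.
case: hU => U [[x0 Ux0] [V oV UE] strict].
have cK : compact K by case: hK.
apply: (not_local_maximizer cK (p := p)) => e e0.
have [[x [Ux qx]]|nex] := pselect (exists x, U x /\
   (n + 2)%:R / vol K <
     sqnorm_coord T (centroid K) x).
  exact: add_point_increases ET pK (strict x Ux) qx e0.
rewrite UE in Ux0 strict nex; case: Ux0 => Vx0 bx0.
apply: (cut_cap_increases hn hK ET pK qp bx0 oV Vx0) e0 => x Vx bx.
split; first by apply: strict.
by rewrite leNgt; apply/negP => h; apply: nex; exists x.
Qed.
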